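(* Let $p\ge 2$ and $q$ be coprime integers, $I_1,I_3>0$, $\eta=I_1/I_3-1$, and consider $L(p;q)$ with the Berger metric and base point $o=\Pi(\mathrm{id})$. For $h\in C$ let $t_{\mathrm{cut}}(h)$ be the cut time of the unit-speed geodesic $\Pi\circ\gamma_h$ (the supremum of $t>0$ such that $\Pi\circ\gamma_h|_{[0,t]}$ is length-minimizing in $L(p;q)$). Then: if $\eta\ge-\frac{p-1}{p}$, then $t_{\mathrm{cut}}(h)=\dfrac{2I_1\tau_\ell(\bar h_3)}{|h|}=2\sqrt{I_1}\sqrt{1+\eta\bar h_3^2}\,\tau_\ell(\bar h_3)$ for all $h\in C$; if $-1<\eta<-\frac{p-1}{p}$, then $$t_{\mathrm{cut}}(h)=\begin{cases}\dfrac{2I_1\pi}{|h|}, & |\bar h_3|\ge\frac{p-1}{p|\eta|},\\[2mm] \dfrac{2I_1\tau_\ell(\bar h_3)}{|h|}, & |\bar h_3|<\frac{p-1}{p|\eta|}.\end{cases}$$ In all cases the cut time equals the first Maxwell time $t_{\max}(h)=2I_1\min(\pi,\tau_\ell(\bar h_3))/|h|$.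
   Context: Identify $S^3=\{(z,w)\in\mathbb{C}^2:|z|^2+|w|^2=1\}$ with $\mathrm{SU}_2$ via $(z,w)\mapsto\begin{pmatrix} z& w\\ -\bar w&\bar z\end{pmatrix}$, write $z=q_0+iq_3$, $w=q_1+iq_2$. The basis of $\mathfrak{su}_2$ is $e_1=\frac12\begin{pmatrix}0&1\\-1&0\end{pmatrix}$, $e_2=\frac12\begin{pmatrix}0&i\\ i&0\end{pmatrix}$, $e_3=\frac12\begin{pmatrix}i&0\\0&-i\end{pmatrix}$. The metric $g$ is the left-invariant metric on $\mathrm{SU}_2$ equal to $I_1u_1^2+I_1u_2^2+I_3u_3^2$ at the identity on $u_1e_1+u_2e_2+u_3e_3$; it is invariant under the $\mathbb{Z}_p$-action $[k]\cdot(z,w)=(e^{2\pi ik/p}z,e^{2\pi ikq/p}w)$, so it descends to the lens space $L(p;q)=S^3/\mathbb{Z}_p$ (projection $\Pi$); this is the Berger metric on $L(p;q)$. Let $C=\{h=(h_1,h_2,h_3)\in\mathfrak{su}_2^*: \frac{h_1^2+h_2^2}{I_1}+\frac{h_3^2}{I_3}=1\}$ (coordinates in the dual basis); each $h\in C$ determines the arclength-parametrized geodesic $\gamma_h$ of $(\mathrm{SU}_2,g)$ from the identity (projection of the Hamiltonian flow of $H=\frac12(\frac{h_1^2+h_2^2}{I_1}+\frac{h_3^2}{I_3})$ starting at $h$); every unit-speed geodesic of $L(p;q)$ from $o$ is $\Pi\circ\gamma_h$ for some $h\in C$. Put $|h|=\sqrt{h_1^2+h_2^2+h_3^2}$, $\bar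 h_i=h_i/|h|$, $\tau=2I_1t/|h|$. Along $\gamma_h$: $q_0=\cos\tau\cos(\tau\eta\bar h_3)-\bar h_3\sin\tau\sin(\tau\eta\bar h_3)$, $q_3=\cos\tau\sin(\tau\eta\bar h_3)+\bar h_3\sin\tau\cos(\tau\eta\bar h_3)$. Define $\ell_\mp(\tau,s)=\cos\tau\sin(\tau\eta s\mp\frac{\pi}{p})+s\sin\tau\cos(\tau\eta s\mp\frac{\pi}{p})$, let $\tau_\ell^\mp(s)$ be the smallest positive root in $\tau$ of $\ell_\mp(\tau,s)=0$ and $\tau_\ell(s)=\min(\tau_\ell^-(s),\tau_\ell^+(s))$. *)

(* Defs.v *)
From Stdlib Require Import Reals ZArith.
From Coquelicot Require Import Coquelicot.
Open Scope R_scope.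

(* A point (z,w) of C^2 with z = q0 + i q3, w = q1 + i q2; identified with the
   matrix [[z, w], [-conj w, conj z]] (an element of SU_2 when on S^3). *)
Record quat := mkQ { q0 : R; q1 : R; q2 : R; q3 : R }.

(* Matrix product (z,w)(z',w') = (z z' - w conj w', z w' + w conj z'),
   written out in real coordinates. *)
Definition qmul (x y : quat) : quat :=
  mkQ (q0 x * q0 y - q3 x * q3 y - q1 x * q1 y - q2 x * q2 y)
      (q0 x * q1 y + q1 x * q0 y - q3 x * q2 y + q2 x * q3 y)
      (q0 x * q2 y + q2 x * q0 y + q3 x * q1 y - q1 x * q3 y)
      (q0 x * q3 y + q3 x * q0 y + q1 x * q2 y - q2 x * q1 y).

(* inverse of an element of SU_2: (conj z, -w) *)
Definition qinv (x : quat) : quat := mkQ (q0 x) (- q1 x) (- q2 x) (- q3 x).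

Definition qid : quat := mkQ 1 0 0 0.

Definition on_S3 (x : quat) : Prop :=
  q0 x ^ 2 + q1 x ^ 2 + q2 x ^ 2 + q3 x ^ 2 = 1.

(* u1 e1 + u2 e2 + u3 e3 in su_2, with
   e1 = 1/2 [[0,1],[-1,0]], e2 = 1/2 [[0,i],[i,0]], e3 = 1/2 [[i,0],[0,-i]] *)
Definition alg (u1 u2 u3 : R) : quat := mkQ 0 (u1 / 2) (u2 / 2) (u3 / 2).

Definition au1 (X : quat) : R := 2 * q1 X.
Definition au2 (X : quat) : R := 2 * q2 X.
Definition au3 (X : quat) : R := 2 * q3 X.

Definition berger_norm (I1 I3 : R) (x v : quat) : R :=
  let X := qmul (qinv x) v in
  sqrt (I1 * au1 X ^ 2 + I1 * au2 X ^ 2 + I3 * au3 X ^ 2).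

Definition C1_curve (c dc : R -> quat) : Prop :=
  forall t,
    is_derive (fun s => q0 (c s)) t (q0 (dc t)) /\
    is_derive (fun s => q1 (c s)) t (q1 (dc t)) /\
    is_derive (fun s => q2 (c s)) t (q2 (dc t)) /\
    is_derive (fun s => q3 (c s)) t (q3 (dc t)) /\
    continuous (fun s => q0 (dc s)) t /\ continuous (fun s => q1 (dc s)) t /\
    continuous (fun s => q2 (dc s)) t /\ continuous (fun s => q3 (dc s)) t.

Definition admissible_curve (c dc : R -> quat) (a b : R) : Prop :=
  a <= b /\ C1_curve c dc /\ (forall t, a <= t <= b -> on_S3 (c t)).

Definition curve_length (I1 I3 : R) (c dc : R -> quat) (a b : R) : R :=
  RInt (fun t => berger_norm I1 I3 (c t) (dc t)) a b.

(* Z_p action [k].(z,w) = (e^{2 pi i k/p} z, e^{2 pi i k q/p} w) *)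
Definition lens_act (p q k : Z) (x : quat) : quat :=
  let a := 2 * PI * IZR k / IZR p in
  let b := 2 * PI * IZR k * IZR q / IZR p in
  mkQ (cos a * q0 x - sin a * q3 x)
      (cos b * q1 x - sin b * q2 x)
      (sin b * q1 x + cos b * q2 x)
      (sin a * q0 x + cos a * q3 x).

(* Pi x = Pi y in L(p;q) *)
Definition lens_equiv (p q : Z) (x y : quat) : Prop :=
  exists k : Z, y = lens_act p q k x.

(* (gam, M) is the trajectory of the Hamiltonian flow of
   H = 1/2 ((h1^2+h2^2)/I1 + h3^2/I3) (left trivialization T*SU_2 = SU_2 x dual of su_2)
   starting at (id, h):  gam' = gam . dH(M),  M' = ad*_{dH(M)} M = M x omega,
   where omega = dH(M) = (M1/I1, M2/I1, M3/I3) and [e1,e2]=e3 (cyclically). *)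
Definition hamiltonian_traj (I1 I3 h1 h2 h3 : R) (gam : R -> quat)
    (M1 M2 M3 : R -> R) : Prop :=
  gam 0 = qid /\ M1 0 = h1 /\ M2 0 = h2 /\ M3 0 = h3 /\
  forall t,
    let w1 := M1 t / I1 in let w2 := M2 t / I1 in let w3 := M3 t / I3 in
    is_derive M1 t (M2 t * w3 - M3 t * w2) /\
    is_derive M2 t (M3 t * w1 - M1 t * w3) /\
    is_derive M3 t (M1 t * w2 - M2 t * w1) /\
    let v := qmul (gam t) (alg w1 w2 w3) in
    is_derive (fun s => q0 (gam s)) t (q0 v) /\
    is_derive (fun s => q1 (gam s)) t (q1 v) /\
    is_derive (fun s => q2 (gam s)) t (q2 v) /\
    is_derive (fun s => q3 (gam s)) t (q3 v).

Definition traj_velocity (I1 I3 : R) (gam : R -> quat) (M1 M2 M3 : R -> R)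
    (t : R) : quat :=
  qmul (gam t) (alg (M1 t / I1) (M2 t / I1) (M3 t / I3)).

(* Pi o gam restricted to [0,t] is length-minimizing in L(p;q): every curve in
   L(p;q) between its endpoints (i.e. every curve in S^3 from a point of the
   fibre of o to a point of the fibre of Pi(gam t)) is at least as long. *)
Definition minimizing_upto (p q : Z) (I1 I3 : R) (gam : R -> quat)
    (M1 M2 M3 : R -> R) (t : R) : Prop :=
  forall (c dc : R -> quat) (a b : R),
    admissible_curve c dc a b ->
    lens_equiv p q qid (c a) -> lens_equiv p q (gam t) (c b) ->
    curve_length I1 I3 gam (traj_velocity I1 I3 gam M1 M2 M3) 0 t
      <= curve_length I1 I3 c dc a b.

Definition is_cut_time (p q : Z) (I1 I3 : R) (gam : R -> quat)
    (M1 M2 M3 : R -> R) (T : R) : Prop :=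
  is_lub (fun t => 0 < t /\ minimizing_upto p q I1 I3 gam M1 M2 M3 t) T.

(* l_-(tau,s) (sg = -1) and l_+(tau,s) (sg = 1) *)
Definition ell (eta : R) (p : Z) (sg : R) (tau s : R) : R :=
  cos tau * sin (tau * eta * s + sg * PI / IZR p)
  + s * sin tau * cos (tau * eta * s + sg * PI / IZR p).

Definition first_pos_root (f : R -> R) (tau : R) : Prop :=
  0 < tau /\ f tau = 0 /\ forall t, 0 < t < tau -> f t <> 0.

(* Main.v *)
Require Import Defs.
From Stdlib Require Import Reals ZArith Lra Lia.
From Coquelicot Require Import Coquelicot.
Open Scope R_scope.

(** A curve of [S^3] enters only through [a], half the length of its projection to the base
    of the Hopf fibration, and [b], half its total displacement along the fibres. Its Berger
    length is at least [2 sqrt (I1 a^2 + I3 b^2)], with equality once the displacement is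
    spread proportionally to the horizontal speed. Spreading instead a displacement [psi]
    and measuring with the round metric gives, for every [psi],
    [acos (Re (z exp (i (psi - b)))) ^ 2 <= a^2 + psi^2] where [z] is the first coordinate
    of the endpoint. Since the translates of the base point differ by phases of [z], the
    minimality of a geodesic before the parameter [min (PI, tau_l)] becomes a two-variable
    inequality, solved by choosing [psi]. Past that parameter an explicit cheaper curve is
    a round geodesic followed by a uniform twist along the fibre, reaching the same fibre
    of the covering: either the mirror image of the given geodesic, or one over a shorter
    circle of the base with suitable holonomy. The comparison of circles rests on the
    exponential map of the round sphere being a contraction. *)

(** * Cosine inequalities *)

Lemma pow2_lt_compat (x y : R) : 0 <= x < y -> x ^ 2 < y ^ 2.
Proof. intros lt_xy; nra. Qed.

Lemma sin2_cos2_pow (x : R) : sin x ^ 2 + cos x ^ 2 = 1.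
Proof. rewrite <- !Rsqr_pow2; apply sin2_cos2. Qed.

Lemma nondecreasing_of_derive (f df : R -> R) (a b : R) :
  a <= b -> (forall t, a <= t <= b -> is_derive f t (df t)) ->
  (forall t, a < t < b -> 0 <= df t) -> f a <= f b.
Proof.
intros le_ab derive_f df_ge0.
destruct (Req_dec a b) as [->|neq_ab]; [lra|].
destruct (MVT_cor2 f df a b) as [c [mvt c_bounds]]; [lra| |].
{ intros c c_bounds; apply is_derive_Reals; auto. }
specialize (df_ge0 c c_bounds); nra.
Qed.

Lemma increasing_of_derive (f df : R -> R) (a b : R) :
  a < b -> (forall t, a <= t <= b -> is_derive f t (df t)) ->
  (forall t, a < t < b -> 0 < df t) -> f a < f b.
Proof.
intros lt_ab derive_f df_gt0.
destruct (MVT_cor2 f df a b lt_ab) as [c [mvt c_bounds]].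
{ intros c c_bounds; apply is_derive_Reals; auto. }
specialize (df_gt0 c c_bounds); nra.
Qed.

Lemma mul_cos_lt_sin (x : R) : 0 < x < PI -> x * cos x < sin x.
Proof.
intros x_bounds.
enough (sin 0 - 0 * cos 0 < sin x - x * cos x) by (rewrite sin_0 in *; lra).
apply (increasing_of_derive (fun t => sin t - t * cos t) (fun t => t * sin t)); [lra| |].
- intros t _; auto_derive; [trivial|ring].
- intros t t_bounds; apply Rmult_lt_0_compat; [lra|apply sin_gt_0; lra].
Qed.

Lemma sin_div_decreasing (x y : R) : 0 < x -> x < y -> y <= PI -> sin y / y < sin x / x.
Proof.
intros x_gt0 lt_xy y_le.
enough (- (sin x / x) < - (sin y / y)) by lra.
apply (increasing_of_derive (fun t => - (sin t / t))
  (fun t => (sin t - t * cos t) / t ^ 2)); [lra| |].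
- intros t t_bounds; auto_derive; [lra|field; lra].
- intros t t_bounds; apply Rdiv_lt_0_compat; [|nra].
  pose proof (mul_cos_lt_sin t); lra.
Qed.

(* The tangent at [L] of [cos] as a function of the square of its argument. *)
Definition cos_sq_tangent (L y : R) : R := cos L - sin L / (2 * L) * (y ^ 2 - L ^ 2).

Lemma cos_sq_tangent_Rabs (L y : R) : cos_sq_tangent L (Rabs y) = cos_sq_tangent L y.
Proof. unfold cos_sq_tangent; now rewrite pow2_abs. Qed.

Lemma cos_Rabs (x : R) : cos (Rabs x) = cos x.
Proof. unfold Rabs; destruct (Rcase_abs x); [apply cos_neg|reflexivity]. Qed.

Lemma cos_sq_tangent_lt (L y : R) : 0 < L <= PI -> Rabs y < L -> cos_sq_tangent L y < cos y.
Proof.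
intros L_bounds lt_yL.
rewrite <- (cos_Rabs y), <- cos_sq_tangent_Rabs.
pose proof (Rabs_pos y) as y_ge0; set (z := Rabs y) in *; unfold cos_sq_tangent.
enough (- cos z - sin L / (2 * L) * z ^ 2 < - cos L - sin L / (2 * L) * L ^ 2) by lra.
apply (increasing_of_derive (fun t => - cos t - sin L / (2 * L) * t ^ 2)
  (fun t => sin t - sin L / L * t)); [lra| |].
- intros t t_bounds; auto_derive; [trivial|field; lra].
- intros t t_bounds.
  pose proof (sin_div_decreasing t L ltac:(lra) ltac:(lra) ltac:(lra)) as slope_lt.
  replace (sin t) with (sin t / t * t) by (field; lra).
  nra.
Qed.

Lemma cos_sq_tangent_le_beyond (L y : R) :
  0 < L -> L <= y <= PI -> cos_sq_tangent L y <= cos y.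
Proof.
intros L_gt0 y_bounds; unfold cos_sq_tangent.
enough (cos L + sin L / (2 * L) * L ^ 2 <= cos y + sin L / (2 * L) * y ^ 2) by lra.
apply (nondecreasing_of_derive (fun t => cos t + sin L / (2 * L) * t ^ 2)
  (fun t => sin L / L * t - sin t)); [lra| |].
- intros t t_bounds; auto_derive; [trivial|field; lra].
- intros t t_bounds.
  pose proof (sin_div_decreasing L t ltac:(lra) ltac:(lra) ltac:(lra)) as slope_lt.
  replace (sin t) with (sin t / t * t) by (field; lra).
  nra.
Qed.

(* [cos (sqrt x)] is convex only on [[0, PI^2]]; beyond, its tangents stay below [-1]. *)
Lemma cos_sq_tangent_le (L y : R) : 0 < L <= PI -> cos_sq_tangent L y <= cos y.
Proof.
intros L_bounds.
destruct (Rlt_le_dec (Rabs y) L) as [lt_yL|ge_yL]; [now apply Rlt_le, cos_sq_tangent_lt|].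
rewrite <- (cos_Rabs y), <- cos_sq_tangent_Rabs.
destruct (Rle_lt_dec (Rabs y) PI) as [y_le|y_gt]; [apply cos_sq_tangent_le_beyond; lra|].
apply Rle_trans with (cos_sq_tangent L PI).
- apply Rplus_le_compat_l, Ropp_le_contravar, Rmult_le_compat_l.
  + apply Rdiv_le_0_compat; [apply sin_ge_0|]; lra.
  + apply Rplus_le_compat_r, pow_incr; lra.
- apply Rle_trans with (cos PI); [apply cos_sq_tangent_le_beyond; lra|].
  rewrite cos_PI; apply COS_bound.
Qed.

Lemma cos_quadratic_mean_le (w x y L : R) :
  0 <= w <= 1 -> 0 <= L <= PI -> L ^ 2 = w * x ^ 2 + (1 - w) * y ^ 2 ->
  cos L <= w * cos x + (1 - w) * cos y.
Proof.
intros w_bounds L_bounds mean_sq.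
destruct (Req_dec L 0) as [->|L_neq0].
- assert (weighted : forall v z, 0 <= v -> v * z ^ 2 <= 0 -> v * cos z = v).
  { intros v z v_ge0 vz_le0.
    destruct (Req_dec v 0) as [->|v_neq0]; [ring|].
    assert (z ^ 2 = 0) as z2_0 by nra.
    assert (z = 0) as -> by nra.
    rewrite cos_0; ring. }
  rewrite cos_0, !weighted; nra.
- pose proof (cos_sq_tangent_le L x ltac:(lra)) as at_x.
  pose proof (cos_sq_tangent_le L y ltac:(lra)) as at_y.
  replace (cos L) with (w * cos_sq_tangent L x + (1 - w) * cos_sq_tangent L y)
    by (unfold cos_sq_tangent; rewrite mean_sq; field; lra).
  apply Rplus_le_compat; apply Rmult_le_compat_l; lra.
Qed.

Lemma cos_quadratic_mean_lt (w x y L : R) :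
  0 < w < 1 -> 0 <= L <= PI -> L ^ 2 = w * x ^ 2 + (1 - w) * y ^ 2 -> x ^ 2 <> y ^ 2 ->
  cos L < w * cos x + (1 - w) * cos y.
Proof.
assert (wlog : forall v a b, 0 < v < 1 -> 0 <= L <= PI ->
  L ^ 2 = v * a ^ 2 + (1 - v) * b ^ 2 -> a ^ 2 < b ^ 2 ->
  cos L < v * cos a + (1 - v) * cos b).
{ intros v a b v_bounds L_bounds mean_sq lt_ab.
  assert (L_gt0 : 0 < L) by nra.
  assert (lt_aL : Rabs a < L).
  { apply Rnot_le_lt; intros ge_aL.
    pose proof (pow_incr L (Rabs a) 2 ltac:(lra)) as ge_sq.
    rewrite pow2_abs in ge_sq; nra. }
  pose proof (cos_sq_tangent_lt L a ltac:(lra) lt_aL) as at_a.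
  pose proof (cos_sq_tangent_le L b ltac:(lra)) as at_b.
  replace (cos L) with (v * cos_sq_tangent L a + (1 - v) * cos_sq_tangent L b)
    by (unfold cos_sq_tangent; rewrite mean_sq; field; lra).
  apply Rplus_lt_le_compat; [apply Rmult_lt_compat_l|apply Rmult_le_compat_l]; lra. }
intros w_bounds L_bounds mean_sq neq_sq.
destruct (Rdichotomy _ _ neq_sq) as [lt_xy|lt_yx]; [now apply wlog|].
pose proof (wlog (1 - w) y x ltac:(lra) L_bounds ltac:(lra) lt_yx); lra.
Qed.

(* The squared third side of the Euclidean triangle with sides [tau], [del] enclosing an
   angle of cosine [s]. *)
Definition euclidean_side_sq (s tau del : R) : R := tau ^ 2 - 2 * tau * s * del + del ^ 2.

Lemma euclidean_side_sq_mean (s tau del : R) :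
  euclidean_side_sq s tau del =
  (1 + s) / 2 * (tau - del) ^ 2 + (1 - (1 + s) / 2) * (tau + del) ^ 2.
Proof. unfold euclidean_side_sq; field. Qed.

Lemma euclidean_side_sq_ge0 (s tau del : R) : -1 <= s <= 1 -> 0 <= euclidean_side_sq s tau del.
Proof.
intros s_bounds; rewrite euclidean_side_sq_mean.
apply Rplus_le_le_0_compat; (apply Rmult_le_pos; [lra|apply pow2_ge_0]).
Qed.

Lemma spherical_side_mean (s tau del : R) :
  cos tau * cos del + s * sin tau * sin del =
  (1 + s) / 2 * cos (tau - del) + (1 - (1 + s) / 2) * cos (tau + del).
Proof. rewrite cos_minus, cos_plus; field. Qed.

(* The exponential map of the round sphere does not increase distances. *)
Lemma spherical_side_le (s tau del sig : R) :
  -1 <= s <= 1 -> 0 <= sig <= PI ->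
  cos sig = cos tau * cos del + s * sin tau * sin del ->
  sig ^ 2 <= euclidean_side_sq s tau del.
Proof.
intros s_bounds sig_bounds cosine_rule.
rewrite spherical_side_mean in cosine_rule.
pose proof (euclidean_side_sq_ge0 s tau del ltac:(lra)) as side_sq_ge0.
rewrite <- (pow2_sqrt _ side_sq_ge0).
pose proof (sqrt_pos (euclidean_side_sq s tau del)) as side_ge0.
apply pow_incr; split; [lra|].
destruct (Rlt_le_dec PI (sqrt (euclidean_side_sq s tau del))) as [side_gt|side_le]; [lra|].
apply cos_decr_0; try lra.
rewrite cosine_rule; apply cos_quadratic_mean_le; try lra.
rewrite pow2_sqrt by assumption; apply euclidean_side_sq_mean.
Qed.

Lemma spherical_side_lt (s tau del sig : R) :
  -1 < s < 1 -> PI < tau -> 0 <= sig <= PI ->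
  cos sig = cos tau * cos del + s * sin tau * sin del ->
  sig ^ 2 < euclidean_side_sq s tau del.
Proof.
intros s_bounds tau_gt sig_bounds cosine_rule.
destruct (Req_dec del 0) as [->|del_neq0].
{ unfold euclidean_side_sq; pose proof (pow2_lt_compat sig tau); lra. }
rewrite spherical_side_mean in cosine_rule.
pose proof (euclidean_side_sq_ge0 s tau del ltac:(lra)) as side_sq_ge0.
rewrite <- (pow2_sqrt _ side_sq_ge0).
pose proof (sqrt_pos (euclidean_side_sq s tau del)) as side_ge0.
apply pow2_lt_compat; split; [lra|].
destruct (Rlt_le_dec PI (sqrt (euclidean_side_sq s tau del))) as [side_gt|side_le]; [lra|].
apply cos_decreasing_0; try lra.
rewrite cosine_rule; apply cos_quadratic_mean_lt; try lra.
- rewrite pow2_sqrt by assumption; apply euclidean_side_sq_mean.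
- assert (tau * del <> 0) by (apply Rmult_integral_contrapositive; lra); lra.
Qed.

Lemma acos_cos_sq_le (x : R) : acos (cos x) ^ 2 <= x ^ 2.
Proof.
replace (x ^ 2) with (euclidean_side_sq 1 x 0) by (unfold euclidean_side_sq; ring).
apply spherical_side_le; [lra|apply acos_bound|].
rewrite cos_acos by apply COS_bound; rewrite cos_0, sin_0; ring.
Qed.

(** * Polar form of the first coordinate *)

Lemma cos_2PI_IZR (x : R) (n : Z) : cos (x + 2 * PI * IZR n) = cos x.
Proof.
destruct (Z_le_dec 0 n) as [n_ge0|n_lt0].
- rewrite <- (Z2Nat.id n n_ge0), <- INR_IZR_INZ.
  replace (2 * PI * INR (Z.to_nat n)) with (2 * INR (Z.to_nat n) * PI) by ring.
  apply cos_period.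
- rewrite <- (cos_period _ (Z.to_nat (- n))), INR_IZR_INZ, Z2Nat.id by lia.
  rewrite opp_IZR; f_equal; ring.
Qed.

Lemma sin_2PI_IZR (x : R) (n : Z) : sin (x + 2 * PI * IZR n) = sin x.
Proof.
rewrite <- !cos_shift.
replace (PI / 2 - (x + 2 * PI * IZR n)) with (PI / 2 - x + 2 * PI * IZR (- n))
  by (rewrite opp_IZR; ring).
apply cos_2PI_IZR.
Qed.

Lemma angle_reduction (x : R) : exists n : Z, Rabs (x + 2 * PI * IZR n) <= PI.
Proof.
pose proof PI_RGT_0 as PI_gt0.
destruct (base_Int_part ((x + PI) / (2 * PI))) as [floor_le floor_gt].
set (k := Int_part ((x + PI) / (2 * PI))) in *.
assert (turns : 2 * PI * ((x + PI) / (2 * PI)) = x + PI) by (field; lra).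
exists (- k)%Z; rewrite opp_IZR; apply Rabs_le; nra.
Qed.

(* Real and imaginary parts of [z = (cos tau + i s sin tau) exp (i chi)]. *)
Definition zre (s tau chi : R) : R := cos tau * cos chi - s * sin tau * sin chi.
Definition zim (s tau chi : R) : R := cos tau * sin chi + s * sin tau * cos chi.

Lemma zre_add (s tau x y : R) : zre s tau x * cos y - zim s tau x * sin y = zre s tau (x + y).
Proof. unfold zre, zim; rewrite cos_plus, sin_plus; ring. Qed.

Lemma zim_add (s tau x y : R) : zre s tau x * sin y + zim s tau x * cos y = zim s tau (x + y).
Proof. unfold zre, zim; rewrite cos_plus, sin_plus; ring. Qed.

Lemma zre_opp (s tau chi : R) : zre (- s) tau (- chi) = zre s tau chi.
Proof. unfold zre; rewrite cos_neg, sin_neg; ring. Qed.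

Lemma zim_opp (s tau chi : R) : zim (- s) tau (- chi) = - zim s tau chi.
Proof. unfold zim; rewrite cos_neg, sin_neg; ring. Qed.

Definition polar (s tau r be : R) : Prop :=
  0 <= r <= 1 /\ r * cos be = cos tau /\ r * sin be = s * sin tau.

Lemma polar_zre (s tau r be chi : R) :
  polar s tau r be -> zre s tau chi = r * cos (be + chi).
Proof. intros [_ [re im]]; unfold zre; rewrite cos_plus, <- re, <- im; ring. Qed.

Lemma polar_zim (s tau r be chi : R) :
  polar s tau r be -> zim s tau chi = r * sin (be + chi).
Proof. intros [_ [re im]]; unfold zim; rewrite sin_plus, <- re, <- im; ring. Qed.

Lemma polar_opp (s tau r be : R) : polar s tau r be -> polar (- s) tau r (- be).
Proof.
intros [r_bounds [re im]]; unfold polar; rewrite cos_neg, sin_neg; repeat split; lra.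
Qed.

Lemma polar_shift (s tau r be : R) (n : Z) :
  polar s tau r be -> polar s tau r (be + 2 * PI * IZR n).
Proof. unfold polar; now rewrite cos_2PI_IZR, sin_2PI_IZR. Qed.

Lemma polar_supplement (s tau r be : R) :
  polar s tau r be -> polar s (PI - tau) r (PI - be).
Proof.
unfold polar; rewrite !cos_minus, !sin_minus, cos_PI, sin_PI.
intros [r_bounds [re im]]; repeat split; lra.
Qed.

Lemma polar_radius_gt0 (s tau r be : R) : s <> 0 -> polar s tau r be -> 0 < r.
Proof.
intros s_neq0 [[r_ge0 _] [re im]].
destruct r_ge0 as [|r_0]; [assumption|exfalso].
rewrite <- r_0, Rmult_0_l in re, im.
assert (sin_tau : sin tau = 0) by (apply (Rmult_eq_reg_l s); lra).
pose proof (sin2_cos2_pow tau) as pythagoras; rewrite <- re, sin_tau in pythagoras; lra.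
Qed.

Lemma polar_coordinates_upper (x y : R) :
  0 <= y -> exists r be : R, 0 <= r /\ 0 <= be <= PI /\ r * cos be = x /\ r * sin be = y.
Proof.
intros y_ge0; pose proof PI_RGT_0 as PI_gt0.
pose proof (pow2_ge_0 x) as x2_ge0; pose proof (pow2_ge_0 y) as y2_ge0.
pose proof (pow2_sqrt (x ^ 2 + y ^ 2) ltac:(lra)) as r_sq.
pose proof (sqrt_pos (x ^ 2 + y ^ 2)) as r_ge0.
set (r := sqrt (x ^ 2 + y ^ 2)) in *.
destruct (Req_dec r 0) as [r_0|r_neq0].
- rewrite r_0 in r_sq; exists 0, 0; repeat split; nra.
- assert (quotient_bounds : -1 <= x / r <= 1).
  { split; [apply Rle_div_r; [lra|nra]|apply Rle_div_l; [lra|nra]]. }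
  exists r, (acos (x / r)).
  split; [assumption|]; split; [apply acos_bound|].
  rewrite cos_acos, sin_acos by assumption; split; [field; assumption|].
  rewrite <- (sqrt_pow2 r) at 1 by assumption.
  rewrite <- sqrt_mult_alt, <- (sqrt_pow2 y) by nra.
  f_equal; rewrite Rsqr_pow2.
  transitivity (r ^ 2 - x ^ 2); [field; assumption|lra].
Qed.

Lemma polar_radius_le1 (s tau r be : R) :
  -1 <= s <= 1 -> r * cos be = cos tau -> r * sin be = s * sin tau -> r <= 1.
Proof.
intros s_bounds re im.
pose proof (sin2_cos2_pow be) as unit_be; pose proof (sin2_cos2_pow tau) as unit_tau.
assert (r_sq : r ^ 2 = (r * cos be) ^ 2 + (r * sin be) ^ 2).
{ transitivity (r ^ 2 * (sin be ^ 2 + cos be ^ 2)); [rewrite unit_be; ring|ring]. }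
rewrite re, im, Rpow_mult_distr in r_sq.
assert (s_sq : s ^ 2 <= 1) by nra.
nra.
Qed.

Lemma polar_exists_upper (s tau : R) :
  0 <= s <= 1 -> 0 <= tau <= PI -> exists r be, polar s tau r be /\ 0 <= be <= PI.
Proof.
intros s_bounds tau_bounds.
destruct (polar_coordinates_upper (cos tau) (s * sin tau))
  as [r [be [r_ge0 [be_bounds [re im]]]]].
{ apply Rmult_le_pos; [lra|apply sin_ge_0; lra]. }
exists r, be; repeat split; try assumption; try lra.
apply (polar_radius_le1 s tau r be); lra.
Qed.

Lemma polar_exists (s tau : R) : -1 <= s <= 1 -> exists r be, polar s tau r be.
Proof.
intros s_bounds.
destruct (Rle_lt_dec 0 (s * sin tau)) as [im_ge0|im_lt0].
- destruct (polar_coordinates_upper (cos tau) (s * sin tau) im_ge0)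
    as [r [be [r_ge0 [_ [re im]]]]].
  exists r, be; repeat split; try assumption.
  apply (polar_radius_le1 s tau r be); lra.
- destruct (polar_coordinates_upper (cos tau) (- (s * sin tau)) ltac:(lra))
    as [r [be [r_ge0 [_ [re im]]]]].
  rewrite <- (Ropp_involutive be), sin_neg in im; rewrite <- cos_neg in re.
  exists r, (- be); repeat split; try lra.
  apply (polar_radius_le1 s tau r (- be)); lra.
Qed.

Lemma polar_cross_ge0 (s t1 t2 r be : R) :
  0 <= s <= 1 -> 0 <= t1 <= t2 -> t2 <= PI -> polar s t1 r be ->
  0 <= be -> be + s * (t2 - t1) <= PI ->
  0 <= s * sin t2 * cos (be + s * (t2 - t1)) - cos t2 * sin (be + s * (t2 - t1)).
Proof.
intros s_bounds t1_bounds t2_le [_ [re im]] be_ge0 be_le.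
replace 0 with (s * sin t1 * cos (be + s * (t1 - t1)) - cos t1 * sin (be + s * (t1 - t1)))
  at 1 by (rewrite Rminus_diag, Rmult_0_r, Rplus_0_r, <- re, <- im; ring).
apply (nondecreasing_of_derive
  (fun t => s * sin t * cos (be + s * (t - t1)) - cos t * sin (be + s * (t - t1)))
  (fun t => (1 - s ^ 2) * sin t * sin (be + s * (t - t1)))); [lra| |].
- intros t _; auto_derive; [trivial|]; unfold Rminus; ring.
- intros t t_bounds; apply Rmult_le_pos; [apply Rmult_le_pos; [nra|apply sin_ge_0; lra]|].
  apply sin_ge_0; nra.
Qed.

Lemma polar_angle_increase_of_le_PI (s t1 t2 r1 r2 b1 b2 : R) :
  0 < s <= 1 -> 0 <= t1 <= t2 -> t2 <= PI -> polar s t1 r1 b1 -> polar s t2 r2 b2 ->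
  0 <= b1 -> b1 + s * (t2 - t1) <= PI -> 0 <= b2 <= PI -> b1 + s * (t2 - t1) <= b2.
Proof.
intros s_bounds t1_bounds t2_le polar1 polar2 b1_ge0 sum_le b2_bounds.
pose proof (polar_cross_ge0 s t1 t2 r1 b1 ltac:(lra) t1_bounds t2_le polar1 b1_ge0 sum_le)
  as cross_ge0.
pose proof (polar_radius_gt0 s t2 r2 b2 ltac:(lra) polar2) as r2_gt0.
destruct polar1 as [r1_bounds [re1 _]]; destruct polar2 as [_ [re2 im2]].
set (x := b1 + s * (t2 - t1)) in *.
rewrite <- re2, <- im2 in cross_ge0.
replace (r2 * sin b2 * cos x - r2 * cos b2 * sin x) with (- (r2 * sin (x - b2)))
  in cross_ge0 by (rewrite sin_minus; ring).
apply Rnot_lt_le; intros lt_b2x.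
destruct (Req_dec (x - b2) PI) as [opposite|not_opposite].
- assert (b2_0 : b2 = 0) by lra.
  rewrite b2_0, sin_0, Rmult_0_r in im2; rewrite b2_0, cos_0 in re2.
  assert (t2_0 : t2 = 0).
  { assert (sin_t2 : sin t2 = 0) by (apply (Rmult_eq_reg_l s); lra).
    destruct (Req_dec t2 PI) as [t2_PI|]; [rewrite t2_PI, cos_PI in re2; lra|].
    destruct (Req_dec t2 0) as [|]; [assumption|].
    pose proof (sin_gt_0 t2); lra. }
  assert (t1_0 : t1 = 0) by lra.
  assert (b1_PI : b1 = PI) by (unfold x in *; rewrite t2_0, t1_0 in *; lra).
  rewrite b1_PI, t1_0, cos_PI, cos_0 in re1; lra.
- pose proof (sin_gt_0 (x - b2) ltac:(lra) ltac:(lra)); nra.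
Qed.

Lemma polar_angle_ge (s tau r be : R) :
  0 <= s <= 1 -> 0 <= tau <= PI -> polar s tau r be -> 0 <= be <= PI -> s * tau <= be.
Proof.
intros s_bounds tau_bounds polar_be be_bounds.
destruct (Req_dec s 0) as [->|s_neq0]; [lra|].
assert (origin : polar s 0 1 0) by (unfold polar; rewrite cos_0, sin_0; repeat split; lra).
pose proof (polar_angle_increase_of_le_PI s 0 tau 1 r 0 be ltac:(lra) ltac:(lra) ltac:(lra)
  origin polar_be) as increase.
nra.
Qed.

Lemma polar_angle_le (s tau r be : R) :
  0 <= s <= 1 -> 0 <= tau <= PI -> polar s tau r be -> 0 <= be <= PI ->
  s * (PI - tau) <= PI - be.
Proof.
intros s_bounds tau_bounds polar_be be_bounds.
apply (polar_angle_ge s (PI - tau) r); try lra; now apply polar_supplement.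
Qed.

Lemma polar_angle_increase (s t1 t2 r1 r2 b1 b2 : R) :
  0 < s <= 1 -> 0 <= t1 <= t2 -> t2 <= PI -> polar s t1 r1 b1 -> polar s t2 r2 b2 ->
  0 <= b1 <= PI -> 0 <= b2 <= PI -> b1 + s * (t2 - t1) <= b2.
Proof.
intros s_bounds t1_bounds t2_le polar1 polar2 b1_bounds b2_bounds.
apply (polar_angle_increase_of_le_PI s t1 t2 r1 r2); try assumption; try lra.
pose proof (polar_angle_le s t1 r1 b1 ltac:(lra) ltac:(lra) polar1 b1_bounds) as upper_bound.
assert (s * (t2 - t1) <= s * (PI - t1)) by (apply Rmult_le_compat_l; lra).
lra.
Qed.

Lemma radius_cos_bound (r x : R) : 0 <= r <= 1 -> -1 <= r * cos x <= 1.
Proof. intros r_bounds; pose proof (COS_bound x); nra. Qed.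

Lemma acos_radius_le (r x y : R) :
  0 <= r <= 1 -> 0 <= x <= y -> y <= PI -> acos (r * cos x) <= acos (r * cos y).
Proof.
intros r_bounds le_xy y_le.
pose proof (acos_bound (r * cos x)); pose proof (acos_bound (r * cos y)).
apply cos_decr_0; try lra.
rewrite !cos_acos by now apply radius_cos_bound.
apply Rmult_le_compat_l, cos_decr_1; lra.
Qed.

Lemma acos_radius_lt (r x y : R) :
  0 < r <= 1 -> 0 <= x < y -> y <= PI -> acos (r * cos x) < acos (r * cos y).
Proof.
intros r_bounds lt_xy y_le.
pose proof (acos_bound (r * cos x)); pose proof (acos_bound (r * cos y)).
apply cos_decreasing_0; try lra.
rewrite !cos_acos by (apply radius_cos_bound; lra).
apply Rmult_lt_compat_l, cos_decreasing_1; lra.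
Qed.

Lemma polar_acos (s tau r be : R) :
  0 <= tau <= PI -> polar s tau r be -> acos (r * cos be) = tau.
Proof. intros tau_bounds [_ [-> _]]; now apply acos_cos. Qed.

Lemma polar_cos_sub (s tau r be x : R) :
  polar s tau r be -> r * cos x = cos tau * cos (be - x) + s * sin tau * sin (be - x).
Proof.
intros [_ [re im]]; rewrite <- re, <- im.
replace x with (be - (be - x)) at 1 by ring; rewrite (cos_minus be); ring.
Qed.

(** * Lower bound for the cost *)

(* Spreading a fibre displacement [psi] along a curve of half horizontal length [a] shows
   that this is necessary for its endpoint to have a first coordinate of modulus [r] and
   argument [d], once untwisted by the fibre displacement of the curve. *)
Definition reachable (a r d : R) : Prop :=
  forall psi, acos (r * cos (d + psi)) ^ 2 <= a ^ 2 + psi ^ 2.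

Lemma reachable_shift (a r d : R) (n : Z) :
  reachable a r d -> reachable a r (d + 2 * PI * IZR n).
Proof.
intros reach psi.
replace (d + 2 * PI * IZR n + psi) with (d + psi + 2 * PI * IZR n) by ring.
rewrite cos_2PI_IZR; apply reach.
Qed.

Lemma reachable_Rabs (a r d : R) : reachable a r d -> reachable a r (Rabs d).
Proof.
intros reach psi; unfold Rabs; destruct (Rcase_abs d); [|apply reach].
rewrite <- cos_neg; replace (- (- d + psi)) with (d + - psi) by ring.
replace (psi ^ 2) with ((- psi) ^ 2) by ring; apply reach.
Qed.

Lemma cos_le_tangent (x y : R) :
  0 <= x <= PI / 2 -> 0 <= y <= PI / 2 -> cos y <= cos x - sin x * (y - x).
Proof.
intros x_bounds y_bounds.
destruct (Rle_lt_dec x y) as [le_xy|lt_yx].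
- enough (- cos x - sin x * x <= - cos y - sin x * y) by lra.
  apply (nondecreasing_of_derive (fun t => - cos t - sin x * t) (fun t => sin t - sin x)); [lra| |].
  + intros t _; auto_derive; [trivial|ring].
  + intros t t_bounds; enough (sin x <= sin t) by lra; apply sin_incr_1; lra.
- enough (cos y + sin x * y <= cos x + sin x * x) by lra.
  apply (nondecreasing_of_derive (fun t => cos t + sin x * t) (fun t => sin x - sin t)); [lra| |].
  + intros t _; auto_derive; [trivial|ring].
  + intros t t_bounds; enough (sin t <= sin x) by lra; apply sin_incr_1; lra.
Qed.

Lemma acos_radius_sq_ge_tangent (s tau r be x : R) :
  0 < tau < PI -> polar s tau r be -> 0 <= be <= PI / 2 -> 0 <= x <= PI / 2 ->
  tau ^ 2 + 2 * (tau * s) * (x - be) <= acos (r * cos x) ^ 2.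
Proof.
intros tau_bounds [r_bounds [re im]] be_bounds x_bounds.
pose proof (cos_sq_tangent_le tau (acos (r * cos x)) ltac:(lra)) as tangent.
unfold cos_sq_tangent in tangent.
rewrite cos_acos in tangent by now apply radius_cos_bound.
set (sig_sq := acos (r * cos x) ^ 2) in *.
pose proof (cos_le_tangent be x be_bounds x_bounds) as concave.
pose proof (sin_gt_0 tau ltac:(lra) ltac:(lra)) as sin_gt0.
assert (scaled : r * cos x <= r * (cos be - sin be * (x - be)))
  by (apply Rmult_le_compat_l; lra).
assert (slope : sin tau * (s * (x - be)) <= sin tau * ((sig_sq - tau ^ 2) / (2 * tau))).
{ replace (sin tau * ((sig_sq - tau ^ 2) / (2 * tau)))
    with (sin tau / (2 * tau) * (sig_sq - tau ^ 2)) by (field; lra).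
  replace (sin tau * (s * (x - be))) with (r * sin be * (x - be)) by (rewrite im; ring).
  lra. }
apply Rmult_le_reg_l, Rle_div_r in slope; lra.
Qed.

Lemma two_mul_le_weighted_sq (k x y : R) : 0 < k -> 2 * x * y <= k * x ^ 2 + y ^ 2 / k.
Proof.
intros k_gt0.
assert (square : k * x ^ 2 + y ^ 2 / k - 2 * x * y = (k * x - y) ^ 2 / k) by (field; lra).
assert (0 <= (k * x - y) ^ 2 / k) by (apply Rdiv_le_0_compat; [apply pow2_ge_0|assumption]).
lra.
Qed.

Lemma cost_lower_bound_neg (eta s tau r be al a B : R) :
  -1 < eta < 0 -> 0 <= tau <= PI -> polar s tau r be ->
  0 <= be <= PI -> 0 <= al <= PI -> be + eta * (tau * s) - B <= al -> reachable a r al ->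
  tau ^ 2 + eta * (tau * s) ^ 2 <= a ^ 2 + B ^ 2 / (1 + eta).
Proof.
intros eta_bounds tau_bounds polar_be be_bounds al_bounds al_ge reach.
pose proof (polar_acos s tau r be tau_bounds polar_be) as acos_be.
set (kap := tau * s) in *.
destruct (Rle_lt_dec be al) as [le_al|lt_al].
- specialize (reach 0); rewrite Rplus_0_r in reach.
  pose proof (acos_radius_le r be al (proj1 polar_be) ltac:(lra) ltac:(lra)) as tau_le.
  rewrite acos_be in tau_le.
  assert (0 <= B ^ 2 / (1 + eta)) by (apply Rdiv_le_0_compat; [apply pow2_ge_0|lra]).
  nra.
- specialize (reach (be - al)).
  rewrite Rplus_minus, acos_be in reach.
  assert ((be - al) ^ 2 <= (B - eta * kap) ^ 2) by (apply pow_incr; lra).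
  assert (square : B ^ 2 / (1 + eta) - eta * kap ^ 2 - (B - eta * kap) ^ 2 =
    - eta * (B - (1 + eta) * kap) ^ 2 / (1 + eta)) by (field; lra).
  assert (0 <= - eta * (B - (1 + eta) * kap) ^ 2 / (1 + eta)).
  { apply Rdiv_le_0_compat; [apply Rmult_le_pos; [lra|apply pow2_ge_0]|lra]. }
  lra.
Qed.

Lemma cost_lower_bound_nonneg (eta s tau r be al a B : R) :
  0 <= eta -> 0 <= s -> 0 < tau < PI -> polar s tau r be ->
  0 <= be -> be + eta * (tau * s) <= PI / 2 ->
  0 <= al <= PI -> be + eta * (tau * s) - B <= al -> reachable a r al ->
  tau ^ 2 + eta * (tau * s) ^ 2 <= a ^ 2 + B ^ 2 / (1 + eta).
Proof.
intros eta_ge0 s_ge0 tau_bounds polar_be be_ge0 phase_le al_bounds al_ge reach.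
assert (convex := fun x => acos_radius_sq_ge_tangent s tau r be x tau_bounds polar_be).
assert (kap_ge0 : 0 <= tau * s) by (apply Rmult_le_pos; lra); set (kap := tau * s) in *.
assert (0 <= eta * kap) by (apply Rmult_le_pos; lra).
(* [psi = kap] unless this leads beyond [PI / 2], where the convexity estimate stops. *)
assert (displacement : exists psi x excess, 0 <= psi <= kap /\ 0 <= x <= PI / 2 /\
  acos (r * cos x) ^ 2 <= a ^ 2 + psi ^ 2 /\ eta * kap + excess <= x - be /\
  psi * (psi - B) <= kap * excess).
{ destruct (Rle_lt_dec (al + kap) (PI / 2)) as [within|beyond];
    [|destruct (Rle_lt_dec al (PI / 2)) as [al_le|al_gt]].
  - exists kap, (al + kap), (kap - B); repeat split; try lra; apply reach.
  - exists (PI / 2 - al), (PI / 2), (Rmax 0 (PI / 2 - al - B)).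
    pose proof (Rmax_l 0 (PI / 2 - al - B)); pose proof (Rmax_r 0 (PI / 2 - al - B)).
    specialize (reach (PI / 2 - al)); rewrite Rplus_minus in reach.
    repeat split; try lra; [|nra].
    unfold Rmax; destruct Rle_dec; lra.
  - exists 0, (PI / 2), 0; repeat split; try lra.
    specialize (reach 0); rewrite Rplus_0_r in reach.
    apply Rle_trans with (2 := reach), pow_incr; split; [apply acos_bound|].
    apply acos_radius_le; [apply polar_be|lra|lra]. }
destruct displacement as [psi [x [excess [psi_bounds [x_bounds [reach_x [x_ge excess_ge]]]]]]].
specialize (convex x ltac:(lra) x_bounds).
pose proof (two_mul_le_weighted_sq (1 + eta) psi B ltac:(lra)) as weighted.
assert (kap * (eta * kap + excess) <= kap * (x - be)) by (apply Rmult_le_compat_l; lra).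
assert (eta * psi ^ 2 <= eta * kap ^ 2) by (apply Rmult_le_compat_l, pow_incr; lra).
lra.
Qed.

(* [a] and [b] are half the horizontal length and half the fibre displacement of a curve
   ending at the [j]-th translate of the point of parameters [(tau, s)]. *)
Definition minimal_cost (eta : R) (p : Z) (s tau : R) : Prop :=
  forall (a b : R) (j : Z),
    (forall psi, acos (zre s tau (tau * eta * s + 2 * PI * IZR j / IZR p + psi - b)) ^ 2
       <= a ^ 2 + psi ^ 2) ->
    tau ^ 2 * (1 + eta * s ^ 2) <= a ^ 2 + b ^ 2 / (1 + eta).

Lemma minimal_cost_opp (eta : R) (p : Z) (s tau : R) :
  minimal_cost eta p (- s) tau -> minimal_cost eta p s tau.
Proof.
intros minimal a b j reach.
replace (s ^ 2) with ((- s) ^ 2) by ring; replace (b ^ 2) with ((- b) ^ 2) by ring.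
apply (minimal a (- b) (- j)%Z); intros psi.
replace (tau * eta * - s + 2 * PI * IZR (- j) / IZR p + psi - - b)
  with (- (tau * eta * s + 2 * PI * IZR j / IZR p + - psi - b))
  by (rewrite opp_IZR; unfold Rdiv; ring).
rewrite zre_opp; replace (psi ^ 2) with ((- psi) ^ 2) by ring; apply reach.
Qed.

Lemma Rabs_translate_ge (x c : R) (k : Z) : 0 <= x <= c -> x <= Rabs (x + 2 * c * IZR k).
Proof.
intros x_bounds.
destruct (Z_lt_le_dec k 0) as [k_lt0|k_ge0].
- assert (IZR k <= -1) by (apply IZR_le; lia).
  rewrite Rabs_left1; nra.
- apply IZR_le in k_ge0; rewrite Rabs_pos_eq; nra.
Qed.

Lemma PI_div_IZR_bounds (p : Z) : (2 <= p)%Z -> 0 < PI / IZR p <= PI / 2.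
Proof.
intros p_ge2; apply IZR_le in p_ge2; pose proof PI_RGT_0.
split; [apply Rdiv_lt_0_compat; lra|].
apply Rmult_le_compat_l, Rinv_le_contravar; lra.
Qed.

Lemma minimal_cost_of_phase_le (eta : R) (p : Z) (s tau r be : R) :
  -1 < eta -> (2 <= p)%Z -> 0 <= s -> 0 < tau < PI -> polar s tau r be -> 0 <= be <= PI ->
  0 <= be + tau * eta * s <= PI / IZR p -> minimal_cost eta p s tau.
Proof.
intros eta_gt p_ge2 s_ge0 tau_bounds polar_be be_bounds phase_bounds a b j reach.
pose proof (PI_div_IZR_bounds p p_ge2) as sector_bounds; apply IZR_le in p_ge2.
set (th := be + tau * eta * s) in *.
destruct (angle_reduction (th + 2 * PI * IZR j / IZR p - b)) as [n al_le].
set (al := Rabs (th + 2 * PI * IZR j / IZR p - b + 2 * PI * IZR n)) in *.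
assert (reach_al : reachable a r al).
{ apply reachable_Rabs, reachable_shift; intros psi.
  specialize (reach psi); rewrite (polar_zre s tau r be) in reach by assumption.
  now replace (th + 2 * PI * IZR j / IZR p - b + psi)
    with (be + (tau * eta * s + 2 * PI * IZR j / IZR p + psi - b)) by (unfold th; ring). }
assert (al_ge : th - Rabs b <= al).
{ pose proof (Rabs_translate_ge th (PI / IZR p) (j + n * p) phase_bounds) as translate_ge.
  pose proof (Rabs_triang_inv (th + 2 * (PI / IZR p) * IZR (j + n * p)) b) as triangle.
  unfold al.
  replace (th + 2 * PI * IZR j / IZR p - b + 2 * PI * IZR n)
    with (th + 2 * (PI / IZR p) * IZR (j + n * p) - b)
    by (rewrite plus_IZR, mult_IZR; field; lra).
  lra. }
assert (al_bounds : 0 <= al <= PI) by (split; [apply Rabs_pos|assumption]).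
rewrite <- (pow2_abs b).
replace (tau ^ 2 * (1 + eta * s ^ 2)) with (tau ^ 2 + eta * (tau * s) ^ 2) by ring.
assert (phase : be + eta * (tau * s) = th) by (unfold th; ring).
destruct (Rlt_le_dec eta 0) as [eta_lt0|eta_ge0].
- apply (cost_lower_bound_neg eta s tau r be al); try assumption; lra.
- apply (cost_lower_bound_nonneg eta s tau r be al); try assumption; lra.
Qed.

(** * Cheaper competitors *)

(* Some point of the fibre is reached more cheaply, by a round geodesic of parameters
   [(sg, u)] twisted uniformly along the Hopf fibre. *)
Definition improvable_cost (eta : R) (p : Z) (s tau : R) : Prop :=
  exists (sg u b : R) (j : Z),
    -1 <= u <= 1 /\
    zre u sg (b - sg * u) = zre s tau (tau * eta * s + 2 * PI * IZR j / IZR p) /\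
    zim u sg (b - sg * u) = zim s tau (tau * eta * s + 2 * PI * IZR j / IZR p) /\
    sg ^ 2 * (1 - u ^ 2) + b ^ 2 / (1 + eta) < tau ^ 2 * (1 + eta * s ^ 2).

Lemma improvable_cost_opp (eta : R) (p : Z) (s tau : R) :
  improvable_cost eta p (- s) tau -> improvable_cost eta p s tau.
Proof.
intros [sg [u [b [j [u_bounds [re [im cheaper]]]]]]].
exists sg, (- u), (- b), (- j)%Z.
replace (- b - sg * - u) with (- (b - sg * u)) by ring.
replace (tau * eta * - s + 2 * PI * IZR j / IZR p)
  with (- (tau * eta * s + 2 * PI * IZR (- j) / IZR p)) in re, im
  by (rewrite opp_IZR; unfold Rdiv; ring).
rewrite zre_opp in re |- *; rewrite zim_opp in im |- *.
replace ((- u) ^ 2) with (u ^ 2) by ring; replace ((- b) ^ 2) with (b ^ 2) by ring.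
replace ((- s) ^ 2) with (s ^ 2) in cheaper by ring.
repeat split; lra.
Qed.

Lemma improvable_cost_of_polar (eta : R) (p : Z) (s tau r be sg u be' b : R) (j : Z) :
  polar s tau r be -> polar u sg r be' -> -1 <= u <= 1 ->
  be' - sg * u + b = be + (tau * eta * s + 2 * PI * IZR j / IZR p) ->
  sg ^ 2 * (1 - u ^ 2) + b ^ 2 / (1 + eta) < tau ^ 2 * (1 + eta * s ^ 2) ->
  improvable_cost eta p s tau.
Proof.
intros polar_be polar_be' u_bounds same_phase cheaper.
exists sg, u, b, j; split; [assumption|].
rewrite (polar_zre _ _ _ _ _ polar_be), (polar_zim _ _ _ _ _ polar_be),
  (polar_zre _ _ _ _ _ polar_be'), (polar_zim _ _ _ _ _ polar_be'), <- same_phase.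
replace (be' - sg * u + b) with (be' + (b - sg * u)) by ring.
repeat split; assumption.
Qed.

Lemma radius_cos_lt1 (r x : R) : 0 <= r < 1 -> -1 < r * cos x < 1.
Proof. intros r_bounds; pose proof (COS_bound x); nra. Qed.

Lemma sin_acos_gt0 (x : R) : -1 < x < 1 -> 0 < sin (acos x).
Proof. intros x_bounds; rewrite sin_acos by lra; apply sqrt_lt_R0; unfold Rsqr; nra. Qed.

(* A lifted circle ending at [r exp (i be)] has half-length [sg = acos (r cos be)] and
   direction [u] with [u sin sg = r sin be]; it turns the fibre by [be - sg u]. *)
Definition circle_holonomy (r be : R) : R :=
  be - acos (r * cos be) * (r * sin be / sin (acos (r * cos be))).

Lemma circle_holonomy_continuity (r : R) : 0 <= r < 1 -> continuity (circle_holonomy r).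
Proof.
intros r_bounds x; unfold circle_holonomy.
pose proof (radius_cos_lt1 r x r_bounds) as cos_bounds.
assert (acos_continuous : continuity_pt (fun y => acos (r * cos y)) x).
{ apply (continuity_pt_comp (fun y => r * cos y) acos); [reg|].
  apply derivable_continuous_pt, derivable_pt_acos, cos_bounds. }
apply continuity_pt_minus; [reg|].
apply continuity_pt_mult; [assumption|].
apply continuity_pt_div; [reg| |now apply Rgt_not_eq, sin_acos_gt0].
apply (continuity_pt_comp (fun y => acos (r * cos y)) sin); [assumption|reg].
Qed.

Lemma circle_with_holonomy_upper (r al : R) :
  0 <= r <= 1 -> 0 <= al <= PI ->
  exists sg u be : R, 0 <= sg <= PI /\ 0 <= u <= 1 /\ 0 <= be <= PI /\
    polar u sg r be /\ al = be - sg * u.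
Proof.
intros r_bounds al_bounds; pose proof PI_RGT_0 as PI_gt0.
destruct (Req_dec r 1) as [->|r_neq1].
- exists PI, (1 - al / PI), PI.
  assert (0 <= al / PI <= 1) by (split; [apply Rdiv_le_0_compat|apply Rle_div_l]; lra).
  unfold polar; rewrite sin_PI; repeat split; try lra; field; lra.
- destruct (IVT_gen (circle_holonomy r) 0 PI al) as [be [be_bounds holonomy]].
  { apply circle_holonomy_continuity; lra. }
  { unfold circle_holonomy; rewrite sin_0, sin_PI, Rmult_0_r, !Rdiv_0_l, !Rmult_0_r, !Rminus_0_r.
    rewrite Rmin_left, Rmax_right; lra. }
  rewrite Rmin_left, Rmax_right in be_bounds by lra.
  pose proof (radius_cos_lt1 r be ltac:(lra)) as cos_bounds.
  pose proof (sin_acos_gt0 (r * cos be) cos_bounds) as sin_gt0.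
  assert (im_ge0 : 0 <= r * sin be) by (apply Rmult_le_pos; [lra|apply sin_ge_0; lra]).
  exists (acos (r * cos be)), (r * sin be / sin (acos (r * cos be))), be.
  split; [apply acos_bound|]; split; [|repeat split; try lra].
  + split; [now apply Rdiv_le_0_compat|].
    apply Rle_div_l; [assumption|]; rewrite Rmult_1_l, sin_acos by lra.
    rewrite <- (sqrt_pow2 (r * sin be)) by assumption; apply sqrt_le_1_alt.
    pose proof (sin2_cos2_pow be); unfold Rsqr; nra.
  + symmetry; apply cos_acos; lra.
  + field; lra.
  + now rewrite <- holonomy.
Qed.

Lemma circle_with_holonomy (r al : R) :
  0 <= r <= 1 ->
  exists sg u be : R, 0 <= sg <= PI /\ -1 <= u <= 1 /\ polar u sg r be /\ al = be - sg * u.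
Proof.
intros r_bounds.
destruct (angle_reduction al) as [n reduced].
pose proof (Rabs_pos (al + 2 * PI * IZR n)) as reduced_ge0.
destruct (circle_with_holonomy_upper r (Rabs (al + 2 * PI * IZR n)) r_bounds)
  as [sg [u [be [sg_bounds [u_bounds [_ [polar_be holonomy]]]]]]]; [lra|].
unfold Rabs in holonomy; destruct (Rcase_abs (al + 2 * PI * IZR n)) as [neg|nonneg].
- exists sg, (- u), (- be + 2 * PI * IZR (- n)).
  do 2 (split; [lra|]); split; [now apply polar_shift, polar_opp|rewrite opp_IZR; lra].
- exists sg, u, (be + 2 * PI * IZR (- n)).
  do 2 (split; [lra|]); split; [now apply polar_shift|rewrite opp_IZR; lra].
Qed.

Lemma improvable_along_fibre (eta : R) (p : Z) (tau : R) :
  -1 < eta -> PI < tau -> improvable_cost eta p 1 tau.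
Proof.
intros eta_gt tau_gt; pose proof PI_RGT_0 as PI_gt0.
pose proof (Rmin_l PI ((tau - PI) * (1 + eta))) as d_le_PI.
pose proof (Rmin_r PI ((tau - PI) * (1 + eta))) as d_le.
assert (d_gt0 : 0 < Rmin PI ((tau - PI) * (1 + eta)))
  by (apply Rmin_glb_lt; [|apply Rmult_lt_0_compat]; lra).
set (d := Rmin PI ((tau - PI) * (1 + eta))) in *.
assert (d_quotient : 0 < d / PI <= 1)
  by (split; [apply Rdiv_lt_0_compat|apply Rle_div_l]; lra).
apply (improvable_cost_of_polar eta p 1 tau 1 tau PI (1 - d / PI) PI (tau * (1 + eta) - d) 0).
- unfold polar; repeat split; lra.
- unfold polar; rewrite sin_PI; repeat split; lra.
- lra.
- rewrite Rmult_0_r, Rdiv_0_l; field; lra.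
- assert (saving : tau ^ 2 * (1 + eta * 1 ^ 2) -
      (PI ^ 2 * (1 - (1 - d / PI) ^ 2) + (tau * (1 + eta) - d) ^ 2 / (1 + eta)) =
    d * (2 * (tau - PI) + d - d / (1 + eta))) by (field; lra).
  assert (d / (1 + eta) <= tau - PI) by (apply Rle_div_l; lra).
  assert (0 < d * (2 * (tau - PI) + d - d / (1 + eta))) by (apply Rmult_lt_0_compat; lra).
  lra.
Qed.

Lemma improvable_beyond_PI (eta : R) (p : Z) (s tau : R) :
  -1 < eta -> -1 < s < 1 -> PI < tau -> improvable_cost eta p s tau.
Proof.
intros eta_gt s_bounds tau_gt.
destruct (polar_exists s tau ltac:(lra)) as [r [be polar_be]].
destruct (circle_with_holonomy r (be - tau * s) (proj1 polar_be))
  as [sg [u [be' [sg_bounds [u_bounds [polar_be' holonomy]]]]]].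
apply (improvable_cost_of_polar eta p s tau r be sg u be' (tau * s * (1 + eta)) 0);
  try assumption.
- rewrite Rmult_0_r, Rdiv_0_l; lra.
- assert (cosine_rule := polar_cos_sub s tau r be be' polar_be).
  rewrite (proj1 (proj2 polar_be')) in cosine_rule.
  pose proof (spherical_side_lt s tau (be - be') sg s_bounds tau_gt sg_bounds cosine_rule)
    as side_lt.
  replace (be - be') with (tau * s - sg * u) in side_lt by lra.
  unfold euclidean_side_sq in side_lt.
  replace ((tau * s * (1 + eta)) ^ 2 / (1 + eta)) with ((tau * s) ^ 2 * (1 + eta)) by (field; lra).
  lra.
Qed.

Lemma shorter_circle_upper (s tau r be al : R) :
  0 <= s <= 1 -> 0 <= tau <= PI -> 0 < r -> polar s tau r be -> be <= PI ->
  0 <= al < be - tau * s ->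
  exists sg u be', 0 <= u <= 1 /\ polar u sg r be' /\ al = be' - sg * u /\
    sg ^ 2 * (1 - u ^ 2) < tau ^ 2 * (1 - s ^ 2).
Proof.
intros s_bounds tau_bounds r_gt0 polar_be be_le al_bounds.
assert (kap_ge0 : 0 <= tau * s) by (apply Rmult_le_pos; lra).
destruct (circle_with_holonomy_upper r al (proj1 polar_be))
  as [sg [u [be' [sg_bounds [u_bounds [be'_bounds [polar_be' holonomy]]]]]]]; [lra|].
exists sg, u, be'; repeat (split; [assumption|]).
assert (acos_sg := polar_acos u sg r be' sg_bounds polar_be').
assert (comparison : forall x, 0 <= x <= PI ->
  acos (r * cos x) ^ 2 - (x - (be - tau * s)) ^ 2 <= tau ^ 2 * (1 - s ^ 2)).
{ intros x x_bounds.
  pose proof (spherical_side_le s tau (be - x) (acos (r * cos x)) ltac:(lra) (acos_bound _))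
    as side_le.
  rewrite cos_acos in side_le by now apply radius_cos_bound, polar_be.
  specialize (side_le (polar_cos_sub s tau r be x polar_be)).
  unfold euclidean_side_sq in side_le; lra. }
replace (sg ^ 2 * (1 - u ^ 2)) with (sg ^ 2 - (sg * u) ^ 2) by ring.
destruct (Rle_lt_dec (be' + (be - tau * s - al)) PI) as [within|beyond].
- specialize (comparison (be' + (be - tau * s - al)) ltac:(lra)).
  replace (be' + (be - tau * s - al) - (be - tau * s)) with (sg * u) in comparison by lra.
  assert (radius_lt := acos_radius_lt r be' (be' + (be - tau * s - al))
    (conj r_gt0 (proj2 (proj1 polar_be))) ltac:(lra) within).
  rewrite acos_sg in radius_lt.
  pose proof (pow2_lt_compat sg _ (conj (proj1 sg_bounds) radius_lt)); lra.
- specialize (comparison PI ltac:(lra)).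
  assert (radius_le := acos_radius_le r be' PI (proj1 polar_be) ltac:(lra) ltac:(lra)).
  rewrite acos_sg in radius_le.
  pose proof (pow_incr sg _ 2 (conj (proj1 sg_bounds) radius_le)).
  pose proof (pow2_lt_compat (PI - (be - tau * s)) (sg * u) ltac:(lra)); lra.
Qed.

Lemma shorter_circle (s tau r be al : R) :
  0 <= s <= 1 -> 0 <= tau <= PI -> 0 < r -> polar s tau r be -> be <= PI ->
  Rabs al < be - tau * s ->
  exists sg u be', -1 <= u <= 1 /\ polar u sg r be' /\ al = be' - sg * u /\
    sg ^ 2 * (1 - u ^ 2) < tau ^ 2 * (1 - s ^ 2).
Proof.
intros s_bounds tau_bounds r_gt0 polar_be be_le al_lt.
destruct (shorter_circle_upper s tau r be (Rabs al)) as
  [sg [u [be' [u_bounds [polar_be' [holonomy shorter]]]]]]; try assumption.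
{ split; [apply Rabs_pos|assumption]. }
unfold Rabs in holonomy; destruct (Rcase_abs al) as [neg|nonneg].
- exists sg, (- u), (- be'); replace ((- u) ^ 2) with (u ^ 2) by ring.
  split; [lra|]; split; [now apply polar_opp|lra].
- exists sg, u, be'; split; [lra|]; split; [assumption|lra].
Qed.

Lemma improvable_of_phase_gt (eta : R) (p : Z) (s tau r be : R) :
  -1 < eta -> (2 <= p)%Z -> 0 <= s <= 1 -> 0 < tau <= PI ->
  0 < r -> polar s tau r be -> 0 <= be <= PI ->
  PI / IZR p < be + tau * eta * s -> improvable_cost eta p s tau.
Proof.
intros eta_gt p_ge2 s_bounds tau_bounds r_gt0 polar_be be_bounds phase_gt.
pose proof (PI_div_IZR_bounds p p_ge2) as sector_bounds; apply IZR_le in p_ge2.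
assert (kap_ge0 : 0 <= tau * s) by (apply Rmult_le_pos; lra).
set (b0 := tau * s * (1 + eta)).
assert (b0_ge0 : 0 <= b0) by (apply Rmult_le_pos; lra).
assert (cost : tau ^ 2 * (1 + eta * s ^ 2) = tau ^ 2 * (1 - s ^ 2) + b0 ^ 2 / (1 + eta))
  by (unfold b0; field; lra).
assert (inv_gt0 : 0 < / (1 + eta)) by (apply Rinv_0_lt_compat; lra).
assert (previous : be + (tau * eta * s + 2 * PI * -1 / IZR p) =
  be - tau * s + b0 - 2 * (PI / IZR p)) by (unfold b0; field; lra).
destruct (Rlt_le_dec (be - tau * s) (PI / IZR p)) as [mirror|circle].
- apply (improvable_cost_of_polar eta p s tau r be tau (- s) (- be)
    (b0 + 2 * (be - tau * s - PI / IZR p)) (-1)); try assumption; try lra.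
  + now apply polar_opp.
  + rewrite cost; replace ((- s) ^ 2) with (s ^ 2) by ring.
    apply Rplus_lt_compat_l, Rmult_lt_compat_r; [assumption|nra].
- pose proof (Rmin_l b0 (PI / IZR p)) as d_le_b0; pose proof (Rmin_r b0 (PI / IZR p)) as d_le.
  assert (d_ge0 : 0 <= Rmin b0 (PI / IZR p)) by (apply Rmin_glb; lra).
  set (d := Rmin b0 (PI / IZR p)) in *.
  assert (smaller_holonomy : Rabs (be - tau * s - 2 * (PI / IZR p) + d) < be - tau * s).
  { apply Rabs_def1; [lra|].
    unfold d, Rmin in *; destruct Rle_dec; lra. }
  destruct (shorter_circle s tau r be _ s_bounds ltac:(lra) r_gt0 polar_be (proj2 be_bounds)
    smaller_holonomy) as [sg [u [be' [u_bounds [polar_be' [holonomy shorter]]]]]].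
  apply (improvable_cost_of_polar eta p s tau r be sg u be' (b0 - d) (-1)); try assumption; [lra|].
  rewrite cost; apply Rplus_lt_le_compat; [assumption|].
  apply Rmult_le_compat_r, pow_incr; lra.
Qed.

(** * First roots *)

Lemma first_pos_root_exists (f : R -> R) (x : R) :
  continuity f -> f 0 <> 0 -> 0 < x -> f 0 * f x <= 0 -> exists t, first_pos_root f t.
Proof.
intros f_continuous f0_neq0 x_gt0 sign_change.
destruct (IVT_cor f 0 x f_continuous ltac:(lra) sign_change) as [z [z_bounds fz_0]].
set (rootless := fun t => 0 <= t /\ forall u, 0 <= u <= t -> f u <> 0).
assert (rootless_0 : rootless 0).
{ split; [lra|]; intros u u_bounds; now replace u with 0 by lra. }
destruct (completeness rootless) as [m [m_upper m_least]].
{ exists z; intros t [_ no_root].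
  apply Rnot_lt_le; intros lt_zt; apply (no_root z); [lra|assumption]. }
{ now exists 0. }
pose proof (m_upper 0 rootless_0) as m_ge0.
assert (no_root_before : forall u, 0 <= u < m -> f u <> 0).
{ intros u u_bounds fu_0; enough (m <= u) by lra.
  apply m_least; intros t [t_ge0 no_root].
  apply Rnot_lt_le; intros lt_ut; apply (no_root u); [lra|assumption]. }
assert (fm_0 : f m = 0).
{ destruct (Req_dec (f m) 0) as [|fm_neq0]; [assumption|exfalso].
  destruct (continuous_neq_0 f m (f_continuous m) fm_neq0) as [eps no_root_near].
  pose proof (cond_pos eps) as eps_gt0.
  enough (rootless (m + eps / 2)) as later by (pose proof (m_upper _ later); lra).
  split; [lra|]; intros u u_bounds.
  destruct (Rlt_le_dec u m) as [lt_um|le_mu]; [apply no_root_before; lra|].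
  replace u with (m + (u - m)) by ring; apply no_root_near, Rabs_def1; lra. }
exists m; repeat split; [|assumption|intros; apply no_root_before; lra].
destruct m_ge0 as [|m_0]; [assumption|now rewrite <- m_0 in fm_0].
Qed.

Lemma same_sign_before_first_root (f : R -> R) (m t : R) :
  continuity f -> f 0 <> 0 -> first_pos_root f m -> 0 <= t < m -> 0 < f 0 * f t.
Proof.
intros f_continuous f0_neq0 [_ [_ no_root]] t_bounds.
apply Rnot_le_lt; intros sign_change.
destruct (IVT_cor f 0 t f_continuous ltac:(lra) sign_change) as [z [z_bounds fz_0]].
destruct (Req_dec z 0) as [->|z_neq0]; [contradiction|].
apply (no_root z); [lra|assumption].
Qed.

Lemma first_pos_root_le (f : R -> R) (m x : R) :
  continuity f -> f 0 <> 0 -> first_pos_root f m -> 0 < x -> f 0 * f x <= 0 -> m <= x.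
Proof.
intros f_continuous f0_neq0 root x_gt0 sign_change.
apply Rnot_lt_le; intros lt_xm.
pose proof (same_sign_before_first_root f m x f_continuous f0_neq0 root); lra.
Qed.

Lemma first_pos_root_opp (f g : R -> R) (m : R) :
  (forall t, g t = - f t) -> first_pos_root f m -> first_pos_root g m.
Proof.
intros opp [m_gt0 [fm_0 no_root]]; repeat split; [assumption|rewrite opp; lra|].
intros t t_bounds; rewrite opp; now apply Ropp_neq_0_compat, no_root.
Qed.

Lemma ell_minus_zim (eta : R) (p : Z) (tau s : R) :
  ell eta p (-1) tau s = zim s tau (tau * eta * s - PI / IZR p).
Proof. unfold ell, zim; replace (-1 * PI / IZR p) with (- (PI / IZR p)) by lra; reflexivity. Qed.

Lemma ell_plus_zim (eta : R) (p : Z) (tau s : R) :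
  ell eta p 1 tau s = zim s tau (tau * eta * s + PI / IZR p).
Proof. unfold ell, zim; now rewrite Rmult_1_l. Qed.

Lemma ell_opp (eta : R) (p : Z) (sg tau s : R) :
  ell eta p (- sg) tau (- s) = - ell eta p sg tau s.
Proof.
change (zim (- s) tau (tau * eta * - s + - sg * PI / IZR p) =
  - zim s tau (tau * eta * s + sg * PI / IZR p)).
rewrite <- zim_opp; f_equal; unfold Rdiv; ring.
Qed.

Lemma ell_continuity (eta : R) (p : Z) (sg s : R) : continuity (fun t => ell eta p sg t s).
Proof. unfold ell; reg. Qed.

Lemma sin_PI_div_IZR_gt0 (p : Z) : (2 <= p)%Z -> 0 < sin (PI / IZR p).
Proof. intros p_ge2; pose proof (PI_div_IZR_bounds p p_ge2); apply sin_gt_0; lra. Qed.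

Lemma ell_minus_0_lt0 (eta : R) (p : Z) (s : R) : (2 <= p)%Z -> ell eta p (-1) 0 s < 0.
Proof.
intros p_ge2; pose proof (sin_PI_div_IZR_gt0 p p_ge2).
rewrite ell_minus_zim; unfold zim.
rewrite !Rmult_0_l, Rminus_0_l, sin_neg, cos_0, sin_0; lra.
Qed.

Lemma ell_plus_0_gt0 (eta : R) (p : Z) (s : R) : (2 <= p)%Z -> 0 < ell eta p 1 0 s.
Proof.
intros p_ge2; pose proof (sin_PI_div_IZR_gt0 p p_ge2).
rewrite ell_plus_zim; unfold zim.
rewrite !Rmult_0_l, Rplus_0_l, cos_0, sin_0; lra.
Qed.

Lemma zim_half_turns (s t chi : R) : sin t = 0 -> zim s t chi = sin (t + chi).
Proof. intros sin_t; unfold zim; rewrite sin_plus, sin_t; ring. Qed.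

Lemma half_turns_between (d y : R) :
  0 < d <= 1 -> 0 <= y -> exists t, 0 < t /\ sin t = 0 /\ y < t * d <= y + PI.
Proof.
intros d_bounds y_ge0; pose proof PI_RGT_0 as PI_gt0.
destruct (archimed (y / (PI * d))) as [up_gt up_le].
set (k := up (y / (PI * d))) in *.
assert (quotient : y / (PI * d) * (PI * d) = y) by (field; lra).
assert (quotient_ge0 : 0 <= y / (PI * d)) by (apply Rdiv_le_0_compat; nra).
exists (IZR k * PI); split; [apply Rmult_lt_0_compat; lra|].
split; [apply sin_eq_0_1; now exists k|].
assert (0 < PI * d) by (apply Rmult_lt_0_compat; lra).
split; nra.
Qed.

Lemma zim_nonneg_early (s k c : R) :
  0 <= s -> 0 <= k -> 0 < c <= PI / 2 ->
  exists x, 0 < x <= PI / 2 /\ x * k <= c /\ 0 <= zim s x (x * k - c).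
Proof.
intros s_ge0 k_ge0 c_bounds.
destruct (Rle_lt_dec (PI / 2 * k) c) as [slow|fast].
- exists (PI / 2); unfold zim; rewrite cos_PI2, sin_PI2, Rmult_0_l, Rplus_0_l, Rmult_1_r.
  assert (0 <= PI / 2 * k) by (apply Rmult_le_pos; lra).
  repeat split; try lra.
  apply Rmult_le_pos, cos_ge_0; lra.
- assert (k_gt0 : 0 < k) by nra.
  assert (time : c / k * k = c) by (field; lra).
  assert (time_bounds : 0 < c / k <= PI / 2)
    by (split; [apply Rdiv_lt_0_compat|apply Rle_div_l]; lra).
  exists (c / k); unfold zim; rewrite time, Rminus_diag, sin_0, cos_0.
  repeat split; try lra.
  pose proof (sin_ge_0 (c / k)); nra.
Qed.

Lemma zim_nonpos_eventually (s k c : R) :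
  0 <= s -> 0 <= k -> 0 < c <= PI / 2 -> exists x, 0 < x /\ zim s x (x * k + c) <= 0.
Proof.
intros s_ge0 k_ge0 c_bounds.
assert (0 <= PI / 2 * k) by (apply Rmult_le_pos; lra).
destruct (Rlt_le_dec (PI / 2 * k + c) (PI / 2)) as [slow|fast];
  [|destruct (Rle_lt_dec (PI / 2 * k + c) PI) as [medium|very_fast]].
- exists PI; split; [lra|].
  rewrite zim_half_turns by apply sin_PI; apply sin_le_0; lra.
- exists (PI / 2); split; [lra|].
  unfold zim; rewrite cos_PI2, sin_PI2.
  assert (cos (PI / 2 * k + c) <= 0) by (apply cos_le_0; lra); nra.
- assert (k_gt0 : 0 < k) by nra.
  assert (time : (PI - c) / k * k = PI - c) by (field; lra).
  assert (time_bounds : 0 < (PI - c) / k <= PI / 2)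
    by (split; [apply Rdiv_lt_0_compat|apply Rle_div_l]; lra).
  exists ((PI - c) / k); split; [lra|].
  unfold zim; rewrite time; replace (PI - c + c) with PI by ring; rewrite sin_PI, cos_PI.
  pose proof (sin_ge_0 ((PI - c) / k)); nra.
Qed.

Lemma zim_sign_changes (s k c : R) :
  0 <= s -> -1 < k -> 0 < c <= PI / 2 ->
  (exists x, 0 < x /\ 0 <= zim s x (x * k - c)) /\
  (exists x, 0 < x /\ zim s x (x * k + c) <= 0).
Proof.
intros s_ge0 k_gt c_bounds.
destruct (Rle_lt_dec 0 k) as [k_ge0|k_lt0].
- split; [|now apply zim_nonpos_eventually].
  destruct (zim_nonneg_early s k c s_ge0 k_ge0 c_bounds) as [x [x_bounds [_ nonneg]]].
  exists x; split; [lra|assumption].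
- split.
  + destruct (half_turns_between (1 + k) c) as [x [x_gt0 [sin_x x_bounds]]]; [lra|lra|].
    exists x; split; [assumption|].
    rewrite zim_half_turns by assumption; apply sin_ge_0; lra.
  + destruct (half_turns_between (1 + k) (PI - c)) as [x [x_gt0 [sin_x x_bounds]]]; [lra|lra|].
    exists x; split; [assumption|].
    rewrite zim_half_turns by assumption; apply sin_le_0; lra.
Qed.

Lemma mul_gt_opp1 (x y : R) : -1 < x -> 0 <= y <= 1 -> -1 < x * y.
Proof. intros x_gt y_bounds; destruct (Rle_lt_dec 0 x); nra. Qed.

Lemma ell_first_roots_exist (eta : R) (p : Z) (s : R) :
  -1 < eta -> (2 <= p)%Z -> 0 <= s <= 1 ->
  exists tm tp, first_pos_root (fun t => ell eta p (-1) t s) tm /\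
    first_pos_root (fun t => ell eta p 1 t s) tp.
Proof.
intros eta_gt p_ge2 s_bounds.
destruct (zim_sign_changes s (eta * s) (PI / IZR p)) as [[x [x_gt0 minus_x]] [y [y_gt0 plus_y]]];
  [lra|now apply mul_gt_opp1|now apply PI_div_IZR_bounds|].
rewrite <- Rmult_assoc, <- ell_minus_zim in minus_x.
rewrite <- Rmult_assoc, <- ell_plus_zim in plus_y.
pose proof (ell_minus_0_lt0 eta p s p_ge2) as minus_0.
pose proof (ell_plus_0_gt0 eta p s p_ge2) as plus_0.
destruct (first_pos_root_exists (fun t => ell eta p (-1) t s) x) as [tm root_minus];
  [apply ell_continuity|lra|assumption|nra|].
destruct (first_pos_root_exists (fun t => ell eta p 1 t s) y) as [tp root_plus];
  [apply ell_continuity|lra|assumption|nra|].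
now exists tm, tp.
Qed.

Definition cut_parameter (eta : R) (p : Z) (s T : R) : Prop :=
  (forall tau, 0 < tau < T -> minimal_cost eta p s tau) /\
  (forall tau, T < tau -> improvable_cost eta p s tau).

Lemma cut_parameter_opp (eta : R) (p : Z) (s T : R) :
  cut_parameter eta p (- s) T -> cut_parameter eta p s T.
Proof.
intros [minimal improvable]; split; intros tau tau_bounds.
- now apply minimal_cost_opp, minimal.
- now apply improvable_cost_opp, improvable.
Qed.

Section PhaseAtRoots.

Variables (eta : R) (p : Z) (s tm tp : R).
Hypotheses (eta_gt : -1 < eta) (p_ge2 : (2 <= p)%Z) (s_bounds : 0 <= s <= 1).
Hypothesis root_minus : first_pos_root (fun t => ell eta p (-1) t s) tm.
Hypothesis root_plus : first_pos_root (fun t => ell eta p 1 t s) tp.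

Lemma ell_minus_root_early : 0 <= eta -> tm <= PI / 2 /\ tm * (eta * s) <= PI / IZR p.
Proof.
intros eta_ge0.
assert (slope_ge0 : 0 <= eta * s) by (apply Rmult_le_pos; lra).
destruct (zim_nonneg_early s (eta * s) (PI / IZR p)) as [x [x_bounds [x_early nonneg]]];
  [lra|assumption|now apply PI_div_IZR_bounds|].
rewrite <- Rmult_assoc, <- ell_minus_zim in nonneg.
pose proof (ell_minus_0_lt0 eta p s p_ge2) as minus_0.
assert (tm_le : tm <= x).
{ apply (first_pos_root_le _ tm x (ell_continuity eta p (-1) s)); [lra|assumption|lra|nra]. }
split; [lra|]; apply Rle_trans with (2 := x_early); now apply Rmult_le_compat_r.
Qed.

Lemma phase_bounds_upto_root (tau r be : R) :
  0 < tau < PI -> tau <= tm -> 0 < r -> polar s tau r be -> 0 <= be <= PI ->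
  0 <= be + tau * eta * s <= PI.
Proof.
intros tau_bounds tau_le r_gt0 polar_be be_bounds.
pose proof (PI_div_IZR_bounds p p_ge2) as sector_bounds.
assert (kap_ge0 : 0 <= tau * s) by (apply Rmult_le_pos; lra).
replace (tau * eta * s) with (eta * (tau * s)) by ring.
destruct (Rle_lt_dec 0 eta) as [eta_ge0|eta_lt0].
- destruct (ell_minus_root_early eta_ge0) as [tm_le phase_le].
  assert (slope_ge0 : 0 <= eta * s) by (apply Rmult_le_pos; lra).
  assert (be_le : be <= PI / 2).
  { apply Rnot_lt_le; intros be_gt.
    pose proof (cos_ge_0 tau ltac:(lra) ltac:(lra)) as cos_tau.
    pose proof (cos_lt_0 be ltac:(lra) ltac:(lra)) as cos_be.
    rewrite <- (proj1 (proj2 polar_be)) in cos_tau; nra. }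
  assert (tau * (eta * s) <= tm * (eta * s)) by (now apply Rmult_le_compat_r).
  assert (0 <= tau * (eta * s)) by (apply Rmult_le_pos; lra).
  lra.
- pose proof (polar_angle_ge s tau r be s_bounds ltac:(lra) polar_be be_bounds); nra.
Qed.

Lemma phase_lt_before_root (tau r be : R) :
  0 < tau < PI -> tau < tm -> polar s tau r be -> 0 <= be <= PI ->
  0 <= be + tau * eta * s < PI / IZR p.
Proof.
intros tau_bounds tau_lt polar_be be_bounds.
pose proof (PI_div_IZR_bounds p p_ge2) as sector_bounds.
pose proof (ell_minus_0_lt0 eta p s p_ge2) as minus_0.
pose proof (same_sign_before_first_root _ tm tau (ell_continuity eta p (-1) s) ltac:(lra)
  root_minus ltac:(lra)) as minus_tau.
assert (minus_lt0 : ell eta p (-1) tau s < 0) by nra.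
rewrite ell_minus_zim, (polar_zim s tau r be) in minus_lt0 by assumption.
assert (r_gt0 : 0 < r) by (destruct (proj1 polar_be) as [[|<-] _]; lra).
pose proof (phase_bounds_upto_root tau r be tau_bounds ltac:(lra) r_gt0 polar_be be_bounds).
split; [lra|]; apply Rnot_le_lt; intros phase_ge.
assert (0 <= sin (be + (tau * eta * s - PI / IZR p))) by (apply sin_ge_0; lra).
nra.
Qed.

Lemma first_root_gt0 : 0 < Rmin tm tp.
Proof. apply Rmin_glb_lt; [apply root_minus|apply root_plus]. Qed.

Lemma ell_at_first_root :
  ell eta p (-1) (Rmin tm tp) s = 0 \/ ell eta p 1 (Rmin tm tp) s = 0.
Proof. unfold Rmin; destruct Rle_dec; [left; apply root_minus|right; apply root_plus]. Qed.

Lemma phase_ge_at_root (r be : R) :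
  Rmin tm tp < PI -> 0 < s -> polar s (Rmin tm tp) r be -> 0 <= be <= PI ->
  PI / IZR p <= be + Rmin tm tp * eta * s.
Proof.
intros root_lt s_gt0 polar_be be_bounds.
pose proof (PI_div_IZR_bounds p p_ge2) as sector_bounds.
pose proof first_root_gt0 as root_gt0.
pose proof (polar_radius_gt0 _ _ _ _ (Rgt_not_eq _ _ s_gt0) polar_be) as r_gt0.
pose proof (phase_bounds_upto_root (Rmin tm tp) r be ltac:(lra) (Rmin_l tm tp) r_gt0 polar_be
  be_bounds) as phase_bounds.
apply Rnot_lt_le; intros phase_lt.
destruct ell_at_first_root as [root|root].
- rewrite ell_minus_zim, (polar_zim s _ r be) in root by assumption.
  assert (sin (be + (Rmin tm tp * eta * s - PI / IZR p)) < 0) by (apply sin_lt_0_var; lra).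
  nra.
- rewrite ell_plus_zim, (polar_zim s _ r be) in root by assumption.
  assert (0 < sin (be + (Rmin tm tp * eta * s + PI / IZR p))) by (apply sin_gt_0; lra).
  nra.
Qed.

Lemma first_root_ge_PI2_of_equator : s = 0 -> PI / 2 <= Rmin tm tp.
Proof.
intros s_0; pose proof first_root_gt0 as root_gt0.
apply Rnot_lt_le; intros root_lt.
pose proof (cos_gt_0 (Rmin tm tp) ltac:(lra) root_lt) as cos_root.
pose proof (sin_PI_div_IZR_gt0 p p_ge2) as sin_sector.
destruct ell_at_first_root as [root|root];
  rewrite ?ell_minus_zim, ?ell_plus_zim, s_0 in root; unfold zim in root.
- rewrite Rmult_0_r, Rminus_0_l, sin_neg in root; nra.
- rewrite Rmult_0_r, Rplus_0_l in root; nra.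
Qed.

Lemma phase_gt_after_root (tau r be : R) :
  Rmin tm tp < tau <= PI -> polar s tau r be -> 0 <= be <= PI ->
  0 < r /\ PI / IZR p < be + tau * eta * s.
Proof.
intros tau_bounds polar_be be_bounds.
pose proof (PI_div_IZR_bounds p p_ge2) as sector_bounds.
pose proof first_root_gt0 as root_gt0.
destruct (Rle_lt_or_eq_dec 0 s (proj1 s_bounds)) as [s_gt0|s_0].
- split; [apply (polar_radius_gt0 s tau r be); [lra|assumption]|].
  destruct (polar_exists_upper s (Rmin tm tp)) as [r0 [be0 [polar_be0 be0_bounds]]]; [lra|lra|].
  pose proof (phase_ge_at_root r0 be0 ltac:(lra) s_gt0 polar_be0 be0_bounds) as phase_ge.
  pose proof (polar_angle_increase s (Rmin tm tp) tau r0 r be0 be ltac:(lra) ltac:(lra)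
    (proj2 tau_bounds) polar_be0 polar_be be0_bounds be_bounds) as increase.
  assert (0 < (1 + eta) * (s * (tau - Rmin tm tp))).
  { apply Rmult_lt_0_compat; [lra|]; apply Rmult_lt_0_compat; lra. }
  lra.
- pose proof (first_root_ge_PI2_of_equator (eq_sym s_0)) as root_ge.
  destruct polar_be as [r_bounds [re im]].
  rewrite <- s_0, Rmult_0_l in im; rewrite <- s_0, Rmult_0_r, Rplus_0_r.
  pose proof (cos_lt_0 tau ltac:(lra) ltac:(lra)) as cos_tau.
  assert (r_gt0 : 0 < r) by (destruct r_bounds as [[|r_0] _]; [lra|rewrite <- r_0 in re; lra]).
  split; [assumption|].
  enough (be = PI) by lra.
  destruct (Req_dec be 0) as [be_0|be_neq0]; [rewrite be_0, cos_0 in re; lra|].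
  apply Rle_antisym; [apply be_bounds|]; apply Rnot_lt_le; intros be_lt.
  pose proof (sin_gt_0 be ltac:(lra) be_lt); nra.
Qed.

Lemma first_root_le_PI : - ((IZR p - 1) / IZR p) <= eta * s -> Rmin tm tp <= PI.
Proof.
intros slope_ge.
pose proof (PI_div_IZR_bounds p p_ge2) as sector_bounds; pose proof (IZR_le _ _ p_ge2) as p_ge2R.
apply Rle_trans with (1 := Rmin_l tm tp).
destruct (Rle_lt_dec 0 eta) as [eta_ge0|eta_lt0]; [destruct (ell_minus_root_early eta_ge0); lra|].
pose proof (ell_minus_0_lt0 eta p s p_ge2) as minus_0.
enough (0 <= ell eta p (-1) PI s).
{ apply (first_pos_root_le _ tm PI (ell_continuity eta p (-1) s)); [lra|assumption|lra|nra]. }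
rewrite ell_minus_zim, zim_half_turns by apply sin_PI.
assert (PI * - ((IZR p - 1) / IZR p) <= PI * (eta * s)) by (apply Rmult_le_compat_l; lra).
replace (PI * - ((IZR p - 1) / IZR p)) with (PI / IZR p - PI) in * by (field; lra).
assert (eta * s <= 0) by nra.
assert (0 <= PI * - (eta * s)) by (apply Rmult_le_pos; lra).
apply sin_ge_0; lra.
Qed.

Lemma first_root_ge_PI : eta * s <= - ((IZR p - 1) / IZR p) -> PI <= Rmin tm tp.
Proof.
intros slope_le.
pose proof (PI_div_IZR_bounds p p_ge2) as sector_bounds; pose proof (IZR_le _ _ p_ge2) as p_ge2R.
pose proof first_root_gt0 as root_gt0.
assert (slope_lt0 : PI * (eta * s) <= PI / IZR p - PI).
{ replace (PI / IZR p - PI) with (PI * - ((IZR p - 1) / IZR p)) by (field; lra).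
  apply Rmult_le_compat_l; lra. }
assert (s_gt0 : 0 < s).
{ destruct (Rle_lt_or_eq_dec 0 s (proj1 s_bounds)) as [|s_0]; [assumption|].
  rewrite <- s_0 in slope_lt0; lra. }
apply Rnot_lt_le; intros root_lt.
destruct (polar_exists_upper s (Rmin tm tp)) as [r [be [polar_be be_bounds]]]; [lra|lra|].
pose proof (phase_ge_at_root r be root_lt s_gt0 polar_be be_bounds) as phase_ge.
pose proof (polar_angle_le s (Rmin tm tp) r be s_bounds ltac:(lra) polar_be be_bounds).
assert (0 < (1 + eta) * (s * (PI - Rmin tm tp))).
{ apply Rmult_lt_0_compat; [lra|]; apply Rmult_lt_0_compat; lra. }
lra.
Qed.

Lemma cut_parameter_first_root : cut_parameter eta p s (Rmin PI (Rmin tm tp)).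
Proof.
split; intros tau tau_bounds.
- pose proof (Rmin_l PI (Rmin tm tp)); pose proof (Rmin_r PI (Rmin tm tp)).
  pose proof (Rmin_l tm tp).
  destruct (polar_exists_upper s tau) as [r [be [polar_be be_bounds]]]; [lra|lra|].
  pose proof (phase_lt_before_root tau r be ltac:(lra) ltac:(lra) polar_be be_bounds).
  apply (minimal_cost_of_phase_le eta p s tau r be); try assumption; lra.
- destruct (Rlt_le_dec PI tau) as [beyond|within].
  + destruct (Req_dec s 1) as [->|s_neq1]; [now apply improvable_along_fibre|].
    apply improvable_beyond_PI; lra.
  + assert (root_lt : Rmin tm tp < tau)
      by (unfold Rmin at 1 in tau_bounds; destruct Rle_dec in tau_bounds; lra).
    pose proof first_root_gt0 as root_gt0.
    destruct (polar_exists_upper s tau) as [r [be [polar_be be_bounds]]]; [lra|lra|].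
    destruct (phase_gt_after_root tau r be (conj root_lt within) polar_be be_bounds)
      as [r_gt0 phase_gt].
    apply (improvable_of_phase_gt eta p s tau r be); try assumption; lra.
Qed.

End PhaseAtRoots.

Lemma cut_parameter_exists (eta : R) (p : Z) (s : R) :
  -1 < eta -> (2 <= p)%Z -> -1 <= s <= 1 ->
  exists tm tp,
    first_pos_root (fun t => ell eta p (-1) t s) tm /\
    first_pos_root (fun t => ell eta p 1 t s) tp /\
    cut_parameter eta p s (Rmin PI (Rmin tm tp)) /\
    (- ((IZR p - 1) / IZR p) <= eta * Rabs s -> Rmin tm tp <= PI) /\
    (eta * Rabs s <= - ((IZR p - 1) / IZR p) -> PI <= Rmin tm tp).
Proof.
intros eta_gt p_ge2 s_bounds.
unfold Rabs; destruct (Rcase_abs s) as [s_lt0|s_ge0].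
- destruct (ell_first_roots_exist eta p (- s)) as [tm [tp [root_minus root_plus]]];
    [assumption|assumption|lra|].
  exists tp, tm; rewrite (Rmin_comm tp tm).
  split; [|split; [|split; [|split]]].
  + apply first_pos_root_opp with (2 := root_plus); intros t.
    rewrite <- ell_opp, Ropp_involutive; f_equal; ring.
  + apply first_pos_root_opp with (2 := root_minus); intros t.
    rewrite <- ell_opp, Ropp_involutive; f_equal; ring.
  + apply cut_parameter_opp, cut_parameter_first_root; try assumption; lra.
  + apply first_root_le_PI; try assumption; lra.
  + apply first_root_ge_PI; try assumption; lra.
- destruct (ell_first_roots_exist eta p s) as [tm [tp [root_minus root_plus]]];
    [assumption|assumption|lra|].
  exists tm, tp; repeat (split; [assumption|]).
  split; [|split].
  + apply cut_parameter_first_root; try assumption; lra.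
  + apply first_root_le_PI; try assumption; lra.
  + apply first_root_ge_PI; try assumption; lra.
Qed.

(** * Calculus of curves of quaternions *)

Lemma quat_eq (x y : quat) :
  q0 x = q0 y -> q1 x = q1 y -> q2 x = q2 y -> q3 x = q3 y -> x = y.
Proof. destruct x, y; simpl; intros; subst; reflexivity. Qed.

Definition qsub (x y : quat) : quat :=
  mkQ (q0 x - q0 y) (q1 x - q1 y) (q2 x - q2 y) (q3 x - q3 y).

Definition qnorm_sq (x : quat) : R := q0 x ^ 2 + q1 x ^ 2 + q2 x ^ 2 + q3 x ^ 2.

Lemma qnorm_sq_eq0 (x : quat) : qnorm_sq x = 0 -> x = mkQ 0 0 0 0.
Proof.
unfold qnorm_sq; intros norm_0.
pose proof (pow2_ge_0 (q0 x)); pose proof (pow2_ge_0 (q1 x)).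
pose proof (pow2_ge_0 (q2 x)); pose proof (pow2_ge_0 (q3 x)).
apply quat_eq; apply Rsqr_0_uniq; rewrite Rsqr_pow2; simpl (q0 (mkQ _ _ _ _)); lra.
Qed.

Lemma qmul_qinv_cancel (x y : quat) : on_S3 x -> qmul x (qmul (qinv x) y) = y.
Proof.
unfold on_S3; intros norm_x.
assert (q0_sq : q0 x ^ 2 = 1 - q1 x ^ 2 - q2 x ^ 2 - q3 x ^ 2) by lra.
apply quat_eq; simpl; ring [q0_sq].
Qed.

Lemma qinv_qmul_cancel (x y : quat) : on_S3 x -> qmul (qinv x) (qmul x y) = y.
Proof.
unfold on_S3; intros norm_x.
assert (q0_sq : q0 x ^ 2 = 1 - q1 x ^ 2 - q2 x ^ 2 - q3 x ^ 2) by lra.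
apply quat_eq; simpl; ring [q0_sq].
Qed.

Definition is_derive_quat (c : R -> quat) (t : R) (v : quat) : Prop :=
  is_derive (fun s => q0 (c s)) t (q0 v) /\ is_derive (fun s => q1 (c s)) t (q1 v) /\
  is_derive (fun s => q2 (c s)) t (q2 v) /\ is_derive (fun s => q3 (c s)) t (q3 v).

Definition continuous_quat (c : R -> quat) (t : R) : Prop :=
  continuous (fun s => q0 (c s)) t /\ continuous (fun s => q1 (c s)) t /\
  continuous (fun s => q2 (c s)) t /\ continuous (fun s => q3 (c s)) t.

Lemma C1_curve_iff (c dc : R -> quat) :
  C1_curve c dc <-> forall t, is_derive_quat c t (dc t) /\ continuous_quat dc t.
Proof.
unfold C1_curve, is_derive_quat, continuous_quat; split; intros C1 t; specialize (C1 t); tauto.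
Qed.

Lemma is_derive_continuous (f : R -> R) (t d : R) : is_derive f t d -> continuous f t.
Proof.
intros derive_f; apply (ex_derive_continuous (K := R_AbsRing) (V := R_NormedModule)).
now exists d.
Qed.

Lemma is_derive_quat_continuous (c : R -> quat) (t : R) (v : quat) :
  is_derive_quat c t v -> continuous_quat c t.
Proof.
intros [derive0 [derive1 [derive2 derive3]]].
repeat split; eapply is_derive_continuous; eassumption.
Qed.

Lemma continuous_sqr (f : R -> R) (t : R) : continuous f t -> continuous (fun s => f s ^ 2) t.
Proof.
intros f_continuous; apply (continuous_ext (fun s => f s * f s)); [intros; simpl; ring|].
now apply (continuous_mult (K := R_AbsRing)).
Qed.

Ltac continuous_poly :=
  lazymatch goal with
  | |- continuous (fun s => @?f s + @?g s) _ =>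
      apply (continuous_plus (V := R_NormedModule) f g); continuous_poly
  | |- continuous (fun s => @?f s - @?g s) _ =>
      apply (continuous_minus (V := R_NormedModule) f g); continuous_poly
  | |- continuous (fun s => - @?f s) _ =>
      apply (continuous_opp (V := R_NormedModule) f); continuous_poly
  | |- continuous (fun s => @?f s * @?g s) _ =>
      apply (continuous_mult (K := R_AbsRing) f g); continuous_poly
  | |- continuous (fun s => @?f s ^ 2) _ => apply (continuous_sqr f); continuous_poly
  | |- _ => first [assumption | apply continuous_const]
  end.

Lemma continuous_qmul (x y : R -> quat) (t : R) :
  continuous_quat x t -> continuous_quat y t -> continuous_quat (fun s => qmul (x s) (y s)) t.
Proof.
intros [x0 [x1 [x2 x3]]] [y0 [y1 [y2 y3]]].
unfold continuous_quat, qmul; simpl; repeat split; continuous_poly.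
Qed.

Lemma continuous_qinv (x : R -> quat) (t : R) :
  continuous_quat x t -> continuous_quat (fun s => qinv (x s)) t.
Proof.
intros [x0 [x1 [x2 x3]]]; unfold continuous_quat, qinv; simpl; repeat split; continuous_poly.
Qed.

Lemma is_derive_qsub (x y : R -> quat) (t : R) (v w : quat) :
  is_derive_quat x t v -> is_derive_quat y t w ->
  is_derive_quat (fun s => qsub (x s) (y s)) t (qsub v w).
Proof.
intros [x0 [x1 [x2 x3]]] [y0 [y1 [y2 y3]]].
split; [|split; [|split]]; now apply (is_derive_minus (V := R_NormedModule)).
Qed.

Lemma is_derive_sum_sq (f0 f1 f2 f3 : R -> R) (t d0 d1 d2 d3 : R) :
  is_derive f0 t d0 -> is_derive f1 t d1 -> is_derive f2 t d2 -> is_derive f3 t d3 ->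
  is_derive (fun s => f0 s ^ 2 + f1 s ^ 2 + f2 s ^ 2 + f3 s ^ 2) t
    (2 * (f0 t * d0 + f1 t * d1 + f2 t * d2 + f3 t * d3)).
Proof.
intros derive0 derive1 derive2 derive3; auto_derive; [repeat split; eexists; eassumption|].
change (fun s => f0 s) with f0; change (fun s => f1 s) with f1.
change (fun s => f2 s) with f2; change (fun s => f3 s) with f3.
rewrite (is_derive_unique _ _ _ derive0), (is_derive_unique _ _ _ derive1),
  (is_derive_unique _ _ _ derive2), (is_derive_unique _ _ _ derive3); ring.
Qed.

Lemma is_derive_qnorm_sq (x : R -> quat) (t : R) (v : quat) :
  is_derive_quat x t v ->
  is_derive (fun s => qnorm_sq (x s)) t (2 * q0 (qmul (qinv (x t)) v)).
Proof.
intros [derive0 [derive1 [derive2 derive3]]].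
replace (q0 (qmul (qinv (x t)) v))
  with (q0 (x t) * q0 v + q1 (x t) * q1 v + q2 (x t) * q2 v + q3 (x t) * q3 v) by (simpl; ring).
exact (is_derive_sum_sq _ _ _ _ _ _ _ _ _ derive0 derive1 derive2 derive3).
Qed.

Lemma constant_of_derive_0 (f : R -> R) : (forall t, is_derive f t 0) -> forall t, f t = f 0.
Proof.
intros derive_0 t.
destruct (Rtotal_order 0 t) as [lt_0t|[<-|lt_t0]]; [symmetry| |]; try reflexivity;
  now apply eq_is_derive.
Qed.

(* Right multiplication by an imaginary quaternion is skew-symmetric, so two solutions stay
   at constant Euclidean distance. *)
Lemma imaginary_flow_unique (w x y : R -> quat) :
  (forall t, q0 (w t) = 0) ->
  (forall t, is_derive_quat x t (qmul (x t) (w t))) ->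
  (forall t, is_derive_quat y t (qmul (y t) (w t))) ->
  x 0 = y 0 -> forall t, x t = y t.
Proof.
intros imaginary flow_x flow_y same_start t.
assert (distance_0 : qsub (x t) (y t) = mkQ 0 0 0 0).
{ apply qnorm_sq_eq0.
  rewrite (constant_of_derive_0 (fun s => qnorm_sq (qsub (x s) (y s)))).
  - rewrite same_start; unfold qnorm_sq, qsub; simpl; ring.
  - intros r.
    replace 0 with (2 * q0 (qmul (qinv (qsub (x r) (y r)))
      (qsub (qmul (x r) (w r)) (qmul (y r) (w r)))))
      by (simpl; rewrite imaginary; ring).
    now apply (is_derive_qnorm_sq (fun s => qsub (x s) (y s))), is_derive_qsub. }
injection distance_0; intros; apply quat_eq; lra.
Qed.

Lemma velocity_on_S3_imaginary (c : R -> quat) (a b t : R) (v : quat) :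
  is_derive_quat c t v -> (forall r, a <= r <= b -> on_S3 (c r)) -> a < t < b ->
  q0 (qmul (qinv (c t)) v) = 0.
Proof.
intros derive_c on_sphere t_bounds.
assert (constant_norm : is_derive (fun s => qnorm_sq (c s)) t 0).
{ apply (is_derive_ext_loc (fun _ => 1)); [|apply (is_derive_const (V := R_NormedModule))].
  apply (locally_interval _ t a b); [apply t_bounds|apply t_bounds|].
  intros r lt_ar lt_rb; symmetry; apply on_sphere; simpl in *; lra. }
pose proof (is_derive_unique _ _ _ (is_derive_qnorm_sq c t v derive_c)) as derivative.
rewrite (is_derive_unique _ _ _ constant_norm) in derivative; lra.
Qed.

(** * Length of curves *)

Lemma is_derive_acos (x : R) : -1 < x < 1 -> is_derive acos x (- / sqrt (1 - x ^ 2)).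
Proof.
intros x_bounds; apply is_derive_Reals.
apply derive_pt_eq_1 with (derivable_pt_acos x x_bounds).
rewrite derive_pt_acos, Rsqr_pow2; unfold Rdiv; ring.
Qed.

Lemma right_limit_le (f g : R -> R) (x d : R) :
  0 < d -> (forall y, x < y < x + d -> f y <= g y) -> continuous f x -> continuous g x ->
  f x <= g x.
Proof.
intros d_gt0 le_fg f_continuous g_continuous.
apply (filterlim_le (F := at_right x) f g (f x) (g x)).
- exists (mkposreal d d_gt0); intros y y_near lt_xy; apply le_fg.
  apply Rabs_def2 in y_near; unfold minus, plus, opp in y_near; simpl in y_near; lra.
- apply filterlim_filter_le_1 with (2 := f_continuous); apply filter_le_within.
- apply filterlim_filter_le_1 with (2 := g_continuous); apply filter_le_within.
Qed.

Section ArcLengthAngle.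

Variables (f df l dl : R -> R) (a b : R).
Hypothesis le_ab : a <= b.
Hypothesis derive_f : forall t, is_derive f t (df t).
Hypothesis derive_l : forall t, is_derive l t (dl t).
Hypothesis f_bounds : forall t, a <= t <= b -> -1 <= f t <= 1.
Hypothesis speed_ge0 : forall t, a < t < b -> 0 <= dl t.
Hypothesis df_le_speed : forall t, a < t < b -> df t ^ 2 <= dl t ^ 2 * (1 - f t ^ 2).
Hypothesis f_start : f a = 1.
Hypothesis l_start : l a = 0.

(* Shrinking [f] to [cos m * f] keeps [acos] differentiable along the curve. *)
Lemma acos_shrunk_le_arc_length (m : R) : 0 < m < PI / 2 -> acos (cos m * f b) <= m + l b.
Proof.
intros m_bounds.
assert (k_bounds : 0 < cos m < 1).
{ split; [apply cos_gt_0; lra|]; rewrite <- cos_0; apply cos_decreasing_1; lra. }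
assert (acos_cos_m : acos (cos m) = m) by (apply acos_cos; lra).
set (k := cos m) in *.
assert (kf_bounds : forall t, a <= t <= b -> -1 < k * f t < 1)
  by (intros t t_bounds; specialize (f_bounds t t_bounds); nra).
enough (l a - acos (k * f a) <= l b - acos (k * f b))
  by (rewrite l_start, f_start, Rmult_1_r, acos_cos_m in *; lra).
apply (nondecreasing_of_derive (fun t => l t - acos (k * f t))
  (fun t => dl t - k * df t * - / sqrt (1 - (k * f t) ^ 2))); [assumption| |].
- intros t t_bounds; apply (is_derive_minus (V := R_NormedModule)); [apply derive_l|].
  apply (is_derive_comp acos (fun t => k * f t)); [now apply is_derive_acos, kf_bounds|].
  apply is_derive_scal, derive_f.
- intros t t_bounds; specialize (kf_bounds t ltac:(lra)).
  assert (root_gt0 : 0 < sqrt (1 - (k * f t) ^ 2)) by (apply sqrt_lt_R0; nra).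
  assert (root_sq : sqrt (1 - (k * f t) ^ 2) ^ 2 = 1 - (k * f t) ^ 2)
    by (apply pow2_sqrt; nra).
  set (root := sqrt (1 - (k * f t) ^ 2)) in *.
  specialize (speed_ge0 t t_bounds); specialize (df_le_speed t t_bounds).
  assert (product_ge0 : 0 <= dl t * root) by (apply Rmult_le_pos; lra).
  assert (le_sq : (k * df t) ^ 2 <= (dl t * root) ^ 2).
  { rewrite !Rpow_mult_distr, root_sq, Rpow_mult_distr.
    assert (k_sq : 0 <= k ^ 2 <= 1) by nra.
    apply Rle_trans with (k ^ 2 * (dl t ^ 2 * (1 - f t ^ 2))); [apply Rmult_le_compat_l; lra|].
    nra. }
  rewrite <- !Rsqr_pow2 in le_sq.
  pose proof (Rsqr_neg_pos_le_0 _ _ le_sq product_ge0).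
  replace (dl t - k * df t * - / root) with ((dl t * root + k * df t) / root) by (field; lra).
  apply Rdiv_le_0_compat; lra.
Qed.

Lemma acos_le_arc_length : acos (f b) <= l b.
Proof.
assert (l_ge0 : l a <= l b) by (apply (nondecreasing_of_derive l dl); auto).
rewrite l_start in l_ge0.
pose proof (acos_bound (f b)) as acos_bounds.
destruct (Rle_lt_dec PI (l b)) as [long|short]; [lra|].
pose proof (f_bounds b ltac:(lra)) as end_bounds.
apply cos_decr_0; try lra; rewrite cos_acos by assumption.
replace (l b) with (0 + l b) by ring; rewrite <- (Rmult_1_l (f b)), <- cos_0.
apply (right_limit_le (fun m => cos (m + l b)) (fun m => cos m * f b) 0
  (Rmin (PI / 2) (PI - l b))).
- apply Rmin_glb_lt; lra.
- intros m m_bounds.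
  pose proof (Rmin_l (PI / 2) (PI - l b)); pose proof (Rmin_r (PI / 2) (PI - l b)).
  pose proof (COS_bound m); pose proof (acos_bound (cos m * f b)).
  rewrite <- (cos_acos (cos m * f b)) by nra.
  apply cos_decr_1; try lra; apply acos_shrunk_le_arc_length; lra.
- apply (continuous_comp (fun m => m + l b) cos); [|apply continuous_cos].
  apply (continuous_plus (V := R_NormedModule)); [apply continuous_id|apply continuous_const].
- apply (continuous_mult (K := R_AbsRing)); [apply continuous_cos|apply continuous_const].
Qed.

End ArcLengthAngle.

Definition horizontal_speed (x v : quat) : R :=
  sqrt (q1 (qmul (qinv x) v) ^ 2 + q2 (qmul (qinv x) v) ^ 2).

Definition fibre_speed (x v : quat) : R := q3 (qmul (qinv x) v).

Definition horizontal_length (c dc : R -> quat) (a t : R) : R :=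
  RInt (fun r => horizontal_speed (c r) (dc r)) a t.

Definition fibre_displacement (c dc : R -> quat) (a t : R) : R :=
  RInt (fun r => fibre_speed (c r) (dc r)) a t.

Lemma horizontal_speed_sq (x v : quat) :
  horizontal_speed x v ^ 2 = q1 (qmul (qinv x) v) ^ 2 + q2 (qmul (qinv x) v) ^ 2.
Proof.
apply pow2_sqrt, Rplus_le_le_0_compat; apply pow2_ge_0.
Qed.

Lemma berger_norm_speeds (I1 I3 : R) (x v : quat) :
  berger_norm I1 I3 x v =
  sqrt (4 * (I1 * horizontal_speed x v ^ 2 + I3 * fibre_speed x v ^ 2)).
Proof.
rewrite horizontal_speed_sq; unfold berger_norm, au1, au2, au3, fibre_speed; f_equal; ring.
Qed.

Lemma horizontal_speed_continuous (c dc : R -> quat) (t : R) :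
  C1_curve c dc -> continuous (fun r => horizontal_speed (c r) (dc r)) t.
Proof.
intros C1; destruct (proj1 (C1_curve_iff c dc) C1 t) as [derive_c continuous_dc].
apply is_derive_quat_continuous in derive_c.
destruct (continuous_qmul _ _ t (continuous_qinv _ t derive_c) continuous_dc)
  as [_ [continuous1 [continuous2 _]]].
apply continuous_sqrt_comp; continuous_poly.
Qed.

Lemma fibre_speed_continuous (c dc : R -> quat) (t : R) :
  C1_curve c dc -> continuous (fun r => fibre_speed (c r) (dc r)) t.
Proof.
intros C1; destruct (proj1 (C1_curve_iff c dc) C1 t) as [derive_c continuous_dc].
apply is_derive_quat_continuous in derive_c.
apply (continuous_qmul _ _ t (continuous_qinv _ t derive_c) continuous_dc).
Qed.

Lemma is_RInt_continuous (f : R -> R) (a b : R) :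
  (forall t, continuous f t) -> is_RInt f a b (RInt f a b).
Proof.
intros f_continuous; apply (RInt_correct (V := R_CompleteNormedModule)).
apply (ex_RInt_continuous (V := R_CompleteNormedModule)); intros; apply f_continuous.
Qed.

Lemma is_derive_RInt_upper (f : R -> R) (a t : R) :
  (forall r, continuous f r) -> is_derive (fun x => RInt f a x) t (f t).
Proof.
intros f_continuous; apply (is_derive_RInt f _ a t); [|apply f_continuous].
apply filter_forall; intros x; now apply is_RInt_continuous.
Qed.

Lemma sqrt_sum_sq_RInt_le (f g : R -> R) (a b : R) :
  a <= b -> (forall t, continuous f t) -> (forall t, continuous g t) ->
  sqrt (RInt f a b ^ 2 + RInt g a b ^ 2) <= RInt (fun t => sqrt (f t ^ 2 + g t ^ 2)) a b.
Proof.
intros le_ab f_continuous g_continuous.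
rewrite <- (pow2_abs (RInt f a b)), <- (pow2_abs (RInt g a b)).
apply (norm_RInt_le (V := prod_NormedModule R_AbsRing R_NormedModule R_NormedModule)
  (fun t => (f t, g t)) (fun t => sqrt (f t ^ 2 + g t ^ 2)) a b
  (RInt f a b, RInt g a b)); [assumption| | |].
- intros t _; rewrite <- (pow2_abs (f t)), <- (pow2_abs (g t)); apply Rle_refl.
- apply (is_RInt_fct_extend_pair (U := R_NormedModule) (V := R_NormedModule));
    now apply is_RInt_continuous.
- apply is_RInt_continuous; intros t; apply continuous_sqrt_comp.
  specialize (f_continuous t); specialize (g_continuous t); continuous_poly.
Qed.

Lemma curve_length_ge (I1 I3 : R) (c dc : R -> quat) (a b : R) :
  0 < I1 -> 0 < I3 -> a <= b -> C1_curve c dc ->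
  2 * sqrt (I1 * horizontal_length c dc a b ^ 2 + I3 * fibre_displacement c dc a b ^ 2)
    <= curve_length I1 I3 c dc a b.
Proof.
intros I1_gt0 I3_gt0 le_ab C1; unfold curve_length.
assert (I1_root := pow2_sqrt (4 * I1) ltac:(lra)).
assert (I3_root := pow2_sqrt (4 * I3) ltac:(lra)).
assert (horizontal_continuous := fun t => horizontal_speed_continuous c dc t C1).
assert (fibre_continuous := fun t => fibre_speed_continuous c dc t C1).
pose proof (sqrt_sum_sq_RInt_le (fun t => sqrt (4 * I1) * horizontal_speed (c t) (dc t))
  (fun t => sqrt (4 * I3) * fibre_speed (c t) (dc t)) a b le_ab) as minkowski.
rewrite (RInt_scal (fun t => horizontal_speed (c t) (dc t))),
  (RInt_scal (fun t => fibre_speed (c t) (dc t))) in minkowski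
  by (eexists; now apply is_RInt_continuous).
replace 2 with (sqrt (2 ^ 2)) at 1 by (apply sqrt_pow2; lra).
rewrite <- sqrt_mult_alt by lra.
eapply Rle_trans; [|eapply Rle_trans; [apply minkowski|]].
- apply Req_le; f_equal; unfold scal; simpl; unfold mult; simpl.
  change (horizontal_length c dc a b) with (RInt (fun t => horizontal_speed (c t) (dc t)) a b).
  change (fibre_displacement c dc a b) with (RInt (fun t => fibre_speed (c t) (dc t)) a b).
  ring [I1_root I3_root].
- intros t; specialize (horizontal_continuous t); continuous_poly.
- intros t; specialize (fibre_continuous t); continuous_poly.
- apply Req_le, RInt_ext; intros t _.
  rewrite berger_norm_speeds, !Rpow_mult_distr, I1_root, I3_root; f_equal; ring.
Qed.

(* The real part of [z exp (i chi)] for the first coordinate [z] of [x]. *)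
Definition twisted_re (x : quat) (chi : R) : R := q0 x * cos chi - q3 x * sin chi.

Lemma twisted_re_complement (x : quat) (chi : R) :
  on_S3 x ->
  1 - twisted_re x chi ^ 2 = (q0 x * sin chi + q3 x * cos chi) ^ 2 +
    (q1 x * cos chi - q2 x * sin chi) ^ 2 + (q2 x * cos chi + q1 x * sin chi) ^ 2.
Proof.
unfold on_S3, twisted_re; intros norm_x.
pose proof (sin2_cos2_pow chi) as unit_chi.
rewrite <- norm_x.
transitivity ((q0 x ^ 2 + q1 x ^ 2 + q2 x ^ 2 + q3 x ^ 2) * (sin chi ^ 2 + cos chi ^ 2) -
  (q0 x * cos chi - q3 x * sin chi) ^ 2); [rewrite unit_chi; ring|ring].
Qed.

Lemma twisted_re_bounds (x : quat) (chi : R) : on_S3 x -> -1 <= twisted_re x chi <= 1.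
Proof.
intros on_sphere; pose proof (twisted_re_complement x chi on_sphere) as complement.
pose proof (pow2_ge_0 (q0 x * sin chi + q3 x * cos chi)).
split; nra.
Qed.

Lemma cauchy_schwarz3 (a1 a2 a3 b1 b2 b3 : R) :
  (a1 * b1 + a2 * b2 + a3 * b3) ^ 2 <= (a1 ^ 2 + a2 ^ 2 + a3 ^ 2) * (b1 ^ 2 + b2 ^ 2 + b3 ^ 2).
Proof.
pose proof (pow2_ge_0 (a1 * b2 - a2 * b1)); pose proof (pow2_ge_0 (a1 * b3 - a3 * b1)).
pose proof (pow2_ge_0 (a2 * b3 - a3 * b2)); lra.
Qed.

(* While [chi] compensates the fibre speed of the curve up to a residual [dps], the curve
   [z exp (i chi)] moves at round speed [sqrt (horizontal_speed ^ 2 + dps ^ 2)]. *)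
Definition twisted_re_speed (x v : quat) (chi dps : R) : R :=
  q0 v * cos chi - q3 v * sin chi - (dps - fibre_speed x v) * (q0 x * sin chi + q3 x * cos chi).

Lemma twisted_re_speed_sq_le (x v : quat) (chi dps : R) :
  on_S3 x -> q0 (qmul (qinv x) v) = 0 ->
  twisted_re_speed x v chi dps ^ 2
    <= (horizontal_speed x v ^ 2 + dps ^ 2) * (1 - twisted_re x chi ^ 2).
Proof.
intros on_sphere imaginary.
rewrite horizontal_speed_sq, twisted_re_complement by assumption.
unfold twisted_re_speed, fibre_speed; set (X := qmul (qinv x) v) in *.
assert (v_eq : v = qmul x X) by (symmetry; now apply qmul_qinv_cancel).
clearbody X; rewrite v_eq; simpl (q0 (qmul x X)); simpl (q3 (qmul x X)); rewrite imaginary.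
pose proof (cauchy_schwarz3 (q1 X) (q2 X) dps (q1 x * cos chi - q2 x * sin chi)
  (q2 x * cos chi + q1 x * sin chi) (q0 x * sin chi + q3 x * cos chi)).
lra.
Qed.

Lemma is_derive_twisted_re (c : R -> quat) (chi : R -> R) (t : R) (v : quat) (dchi : R) :
  is_derive_quat c t v -> is_derive chi t (dchi - fibre_speed (c t) v) ->
  is_derive (fun r => twisted_re (c r) (chi r)) t (twisted_re_speed (c t) v (chi t) dchi).
Proof.
assert (product : forall x y dx dy d,
  is_derive x t dx -> is_derive y t dy -> is_derive chi t d ->
  is_derive (fun r => x r * cos (chi r) - y r * sin (chi r)) t
    (dx * cos (chi t) - dy * sin (chi t) - d * (x t * sin (chi t) + y t * cos (chi t)))).
{ intros x y dx dy d derive_x derive_y derive_chi.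
  auto_derive; [repeat split; eexists; eassumption|].
  change (fun r => x r) with x; change (fun r => y r) with y; change (fun r => chi r) with chi.
  rewrite (is_derive_unique _ _ _ derive_x), (is_derive_unique _ _ _ derive_y),
    (is_derive_unique _ _ _ derive_chi); ring. }
intros [derive0 [_ [_ derive3]]] derive_chi; exact (product _ _ _ _ _ derive0 derive3 derive_chi).
Qed.

Section TwistedEndpoint.

Variables (c dc : R -> quat) (a b chi : R).
Hypothesis curve : admissible_curve c dc a b.
Hypotheses (start_re : q0 (c a) = cos chi) (start_im : q3 (c a) = - sin chi).

Local Notation B := (fibre_displacement c dc a b).

(* The displacement [psi] is spread along the curve according to the profile [Phi]. *)
Lemma acos_twisted_re_le (A psi : R) (Phi phi : R -> R) :
  (forall t, is_derive Phi t (phi t)) -> Phi a = 0 -> Phi b = 1 ->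
  (forall t, 0 <= phi t) -> (forall t, horizontal_speed (c t) (dc t) <= A * phi t) ->
  acos (twisted_re (c b) (chi + psi - B)) <= sqrt (A ^ 2 + psi ^ 2).
Proof.
intros derive_Phi Phi_a Phi_b phi_ge0 speed_le.
destruct curve as [le_ab [C1 on_sphere]].
assert (length_sq : sqrt (A ^ 2 + psi ^ 2) ^ 2 = A ^ 2 + psi ^ 2)
  by (apply pow2_sqrt, Rplus_le_le_0_compat; apply pow2_ge_0).
pose proof (sqrt_pos (A ^ 2 + psi ^ 2)) as length_ge0.
set (S := sqrt (A ^ 2 + psi ^ 2)) in *.
set (twist := fun t => chi + psi * Phi t - fibre_displacement c dc a t).
assert (derive_twist : forall t, is_derive twist t (psi * phi t - fibre_speed (c t) (dc t))).
{ intros t; apply (is_derive_minus (V := R_NormedModule)).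
  - rewrite <- (Rplus_0_l (psi * phi t)).
    apply (is_derive_plus (V := R_NormedModule)); [apply (is_derive_const (V := R_NormedModule))|].
    apply is_derive_scal, derive_Phi.
  - apply (is_derive_RInt_upper (fun r => fibre_speed (c r) (dc r))).
    intros r; now apply fibre_speed_continuous. }
assert (twist_a : twist a = chi).
{ unfold twist, fibre_displacement; rewrite RInt_point, Phi_a; unfold zero; simpl; ring. }
replace (chi + psi - B) with (twist b) by (unfold twist; rewrite Phi_b; ring).
replace S with (S * Phi b) by (rewrite Phi_b; ring).
apply (acos_le_arc_length (fun t => twisted_re (c t) (twist t))
  (fun t => twisted_re_speed (c t) (dc t) (twist t) (psi * phi t))
  (fun t => S * Phi t) (fun t => S * phi t) a b); [assumption| | | | | | |].
- intros t; apply is_derive_twisted_re; [apply (proj1 (C1_curve_iff c dc) C1)|apply derive_twist].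
- intros t; apply is_derive_scal, derive_Phi.
- intros t t_bounds; now apply twisted_re_bounds, on_sphere.
- intros t _; now apply Rmult_le_pos.
- intros t t_bounds.
  assert (imaginary : q0 (qmul (qinv (c t)) (dc t)) = 0).
  { apply (velocity_on_S3_imaginary c a b); try assumption; apply (proj1 (C1_curve_iff c dc) C1). }
  pose proof (twisted_re_bounds (c t) (twist t) (on_sphere t ltac:(lra))) as re_bounds.
  eapply Rle_trans; [apply twisted_re_speed_sq_le; [apply on_sphere; lra|assumption]|].
  apply Rmult_le_compat_r; [nra|].
  rewrite !Rpow_mult_distr, length_sq.
  assert (horizontal_speed (c t) (dc t) ^ 2 <= (A * phi t) ^ 2)
    by (apply pow_incr; split; [apply sqrt_pos|apply speed_le]).
  lra.
- rewrite twist_a; unfold twisted_re; rewrite start_re, start_im.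
  pose proof (sin2_cos2_pow chi); lra.
- rewrite Phi_a; ring.
Qed.

Lemma sqrt_shift_le (A psi eps : R) :
  0 <= A -> 0 <= eps -> sqrt ((A + eps) ^ 2 + psi ^ 2) <= sqrt (A ^ 2 + psi ^ 2) + eps.
Proof.
intros A_ge0 eps_ge0.
pose proof (pow2_ge_0 psi) as psi_sq.
assert (A_le : A <= sqrt (A ^ 2 + psi ^ 2)).
{ rewrite <- (sqrt_pow2 A) at 1 by assumption; apply sqrt_le_1_alt; lra. }
rewrite <- (sqrt_pow2 (sqrt (A ^ 2 + psi ^ 2) + eps)) by lra.
apply sqrt_le_1_alt.
pose proof (pow2_sqrt (A ^ 2 + psi ^ 2) ltac:(nra)); nra.
Qed.

Lemma acos_twisted_re_le_length (psi : R) :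
  a < b ->
  acos (twisted_re (c b) (chi + psi - B)) <= sqrt (horizontal_length c dc a b ^ 2 + psi ^ 2).
Proof.
intros lt_ab; destruct curve as [_ [C1 _]].
set (speed := fun r => horizontal_speed (c r) (dc r)).
assert (speed_ge0 : forall r, 0 <= speed r) by (intros; apply sqrt_pos).
assert (derive_length : forall t, is_derive (fun t => horizontal_length c dc a t) t (speed t)).
{ intros t; apply (is_derive_RInt_upper speed); intros r; now apply horizontal_speed_continuous. }
assert (length_a : horizontal_length c dc a a = 0)
  by apply (RInt_point (V := R_CompleteNormedModule)).
set (A := horizontal_length c dc a b).
assert (A_ge0 : 0 <= A).
{ rewrite <- length_a; apply (nondecreasing_of_derive (fun t => horizontal_length c dc a t) speed);
    auto; lra. }
apply le_epsilon; intros eps eps_gt0.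
apply Rle_trans with (2 := sqrt_shift_le A psi eps A_ge0 (Rlt_le _ _ eps_gt0)).
assert (k_ge0 : 0 < eps / (b - a)) by (apply Rdiv_lt_0_compat; lra).
(* The uniform contribution [eps] keeps the profile defined for horizontal length [0]. *)
apply (acos_twisted_re_le (A + eps) psi
  (fun t => / (A + eps) * (horizontal_length c dc a t + eps / (b - a) * (t - a)))
  (fun t => / (A + eps) * (speed t + eps / (b - a)))).
- intros t; apply is_derive_scal, (is_derive_plus (V := R_NormedModule)); [apply derive_length|].
  auto_derive; [trivial|ring].
- rewrite length_a; ring.
- fold A; field; lra.
- intros t; apply Rmult_le_pos; [apply Rlt_le, Rinv_0_lt_compat; lra|].
  specialize (speed_ge0 t); lra.
- intros t; fold (speed t); rewrite <- Rmult_assoc, Rinv_r by lra; lra.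
Qed.

Lemma acos_twisted_re_sq_le (psi : R) :
  acos (twisted_re (c b) (chi + psi - B)) ^ 2 <= horizontal_length c dc a b ^ 2 + psi ^ 2.
Proof.
destruct (Rle_lt_or_eq_dec a b (proj1 curve)) as [lt_ab|eq_ab].
- rewrite <- pow2_sqrt by (apply Rplus_le_le_0_compat; apply pow2_ge_0).
  apply pow_incr; split; [apply acos_bound|now apply acos_twisted_re_le_length].
- unfold horizontal_length, fibre_displacement.
  rewrite <- eq_ab, !(RInt_point (V := R_CompleteNormedModule)).
  change (zero (G := R_CompleteNormedModule)) with 0.
  unfold twisted_re; rewrite start_re, start_im.
  replace (cos chi * cos (chi + psi - 0) - - sin chi * sin (chi + psi - 0)) with (cos psi).
  + pose proof (acos_cos_sq_le psi); lra.
  + replace psi with (chi + psi - 0 - chi) at 1 by ring; rewrite cos_minus; ring.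
Qed.

End TwistedEndpoint.

(** * Twisted geodesics and the Hamiltonian flow *)

(* [exp (2 t om (w1 e1 + w2 e2 + u e3)) exp (2 t ep e3)]. *)
Definition twisted (om u w1 w2 ep t : R) : quat :=
  mkQ (zre u (om * t) (ep * t))
      (sin (om * t) * (w1 * cos (ep * t) + w2 * sin (ep * t)))
      (sin (om * t) * (w2 * cos (ep * t) - w1 * sin (ep * t)))
      (zim u (om * t) (ep * t)).

Definition twisted_rate (om u w1 w2 ep t : R) : quat :=
  mkQ 0 (om * (w1 * cos (2 * (ep * t)) + w2 * sin (2 * (ep * t))))
        (om * (w2 * cos (2 * (ep * t)) - w1 * sin (2 * (ep * t))))
        (om * u + ep).

Definition twisted_velocity (om u w1 w2 ep t : R) : quat :=
  qmul (twisted om u w1 w2 ep t) (twisted_rate om u w1 w2 ep t).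

Lemma twisted_0 (om u w1 w2 ep : R) : twisted om u w1 w2 ep 0 = qid.
Proof.
unfold twisted, zre, zim; rewrite !Rmult_0_r, cos_0, sin_0; apply quat_eq; simpl; ring.
Qed.

Lemma rotation_sq (x y th : R) :
  (x * cos th + y * sin th) ^ 2 + (y * cos th - x * sin th) ^ 2 = x ^ 2 + y ^ 2.
Proof.
transitivity ((x ^ 2 + y ^ 2) * (sin th ^ 2 + cos th ^ 2)); [ring|].
rewrite sin2_cos2_pow; ring.
Qed.

Lemma twisted_on_S3 (om u w1 w2 ep t : R) :
  w1 ^ 2 + w2 ^ 2 = 1 - u ^ 2 -> on_S3 (twisted om u w1 w2 ep t).
Proof.
intros unit_axis; unfold on_S3; simpl q0; simpl q1; simpl q2; simpl q3.
pose proof (rotation_sq (cos (om * t)) (u * sin (om * t)) (- (ep * t))) as first_coordinate.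
pose proof (rotation_sq w1 w2 (ep * t)) as second_coordinate.
pose proof (sin2_cos2_pow (om * t)) as unit_om.
unfold zre, zim; rewrite cos_neg, sin_neg in first_coordinate.
rewrite !Rpow_mult_distr.
transitivity (cos (om * t) ^ 2 + (u * sin (om * t)) ^ 2 + sin (om * t) ^ 2 * (w1 ^ 2 + w2 ^ 2)).
- rewrite <- first_coordinate, <- second_coordinate; ring.
- rewrite unit_axis; lra.
Qed.

Lemma is_derive_twisted (om u w1 w2 ep t : R) :
  w1 ^ 2 + w2 ^ 2 = 1 - u ^ 2 ->
  is_derive_quat (twisted om u w1 w2 ep) t (twisted_velocity om u w1 w2 ep t).
Proof.
intros unit_axis; unfold is_derive_quat.
cbv [twisted_velocity qmul twisted twisted_rate zre zim q0 q1 q2 q3].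
rewrite cos_2a, sin_2a.
pose proof (sin2_cos2_pow (ep * t)) as unit_ep.
assert (cos_sq : cos (ep * t) ^ 2 = 1 - sin (ep * t) ^ 2) by lra.
assert (w1_sq : w1 ^ 2 = 1 - u ^ 2 - w2 ^ 2) by lra.
split; [|split; [|split]]; (auto_derive; [trivial|]);
  set (cos_om := cos (om * t)) in *; set (sin_om := sin (om * t)) in *;
  set (cos_ep := cos (ep * t)) in *; set (sin_ep := sin (ep * t)) in *;
  clearbody cos_om sin_om cos_ep sin_ep; ring [cos_sq w1_sq].
Qed.

Lemma twisted_admissible (om u w1 w2 ep : R) :
  w1 ^ 2 + w2 ^ 2 = 1 - u ^ 2 ->
  admissible_curve (twisted om u w1 w2 ep) (twisted_velocity om u w1 w2 ep) 0 1.
Proof.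
intros unit_axis; split; [lra|]; split; [|intros; now apply twisted_on_S3].
apply C1_curve_iff; intros t; split; [now apply is_derive_twisted|].
apply continuous_qmul.
- eapply is_derive_quat_continuous, is_derive_twisted, unit_axis.
- split; [|split; [|split]]; simpl; try apply continuous_const;
    apply (ex_derive_continuous (K := R_AbsRing) (V := R_NormedModule)); auto_derive; trivial.
Qed.

Lemma berger_norm_left (I1 I3 u1 u2 u3 : R) (x : quat) :
  on_S3 x ->
  berger_norm I1 I3 x (qmul x (mkQ 0 u1 u2 u3)) =
  sqrt (4 * (I1 * (u1 ^ 2 + u2 ^ 2) + I3 * u3 ^ 2)).
Proof.
intros on_sphere; unfold berger_norm; rewrite qinv_qmul_cancel by assumption.
unfold au1, au2, au3; simpl q1; simpl q2; simpl q3; f_equal; ring.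
Qed.

Lemma curve_length_of_constant_speed (I1 I3 speed a b : R) (c dc : R -> quat) :
  (forall t, berger_norm I1 I3 (c t) (dc t) = speed) ->
  curve_length I1 I3 c dc a b = (b - a) * speed.
Proof.
intros constant_speed; unfold curve_length.
rewrite (RInt_ext _ (fun _ => speed)) by (intros; apply constant_speed).
apply (RInt_const (V := R_CompleteNormedModule)).
Qed.

Lemma twisted_length (I1 I3 om u w1 w2 ep : R) :
  w1 ^ 2 + w2 ^ 2 = 1 - u ^ 2 ->
  curve_length I1 I3 (twisted om u w1 w2 ep) (twisted_velocity om u w1 w2 ep) 0 1 =
  sqrt (4 * (I1 * (om ^ 2 * (1 - u ^ 2)) + I3 * (om * u + ep) ^ 2)).
Proof.
intros unit_axis.
rewrite (curve_length_of_constant_speed _ _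
  (sqrt (4 * (I1 * (om ^ 2 * (1 - u ^ 2)) + I3 * (om * u + ep) ^ 2)))); [ring|].
intros t; unfold twisted_velocity, twisted_rate.
rewrite berger_norm_left by now apply twisted_on_S3.
rewrite <- unit_axis, <- (rotation_sq w1 w2 (2 * (ep * t))); f_equal; ring.
Qed.

Lemma twisted_reaches (sg u ep : R) (y : quat) :
  on_S3 y -> q0 y = zre u sg ep -> q3 y = zim u sg ep -> -1 <= u <= 1 ->
  exists w1 w2, w1 ^ 2 + w2 ^ 2 = 1 - u ^ 2 /\ twisted sg u w1 w2 ep 1 = y.
Proof.
unfold on_S3; intros norm_y re im u_bounds.
pose proof (sin2_cos2_pow sg) as unit_sg; pose proof (sin2_cos2_pow ep) as unit_ep.
assert (modulus : q1 y ^ 2 + q2 y ^ 2 = (1 - u ^ 2) * sin sg ^ 2).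
{ assert (zre u sg ep ^ 2 + zim u sg ep ^ 2 =
    (cos sg ^ 2 + u ^ 2 * sin sg ^ 2) * (sin ep ^ 2 + cos ep ^ 2)) as first_modulus
    by (unfold zre, zim; ring).
  rewrite unit_ep, <- re, <- im in first_modulus; lra. }
unfold twisted; rewrite !Rmult_1_r.
destruct (Req_dec (sin sg) 0) as [sin_0|sin_neq0].
- exists (sqrt (1 - u ^ 2)), 0; split; [rewrite pow2_sqrt; nra|].
  rewrite sin_0 in *.
  assert (q1 y = 0) by nra; assert (q2 y = 0) by nra.
  apply quat_eq; simpl; lra.
- exists ((q1 y * cos ep - q2 y * sin ep) / sin sg), ((q2 y * cos ep + q1 y * sin ep) / sin sg).
  split.
  + transitivity ((q1 y ^ 2 + q2 y ^ 2) * (sin ep ^ 2 + cos ep ^ 2) / sin sg ^ 2);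
      [field; assumption|].
    rewrite modulus, unit_ep; field; assumption.
  + apply quat_eq; simpl; [now symmetry| | |now symmetry].
    * transitivity (q1 y * (sin ep ^ 2 + cos ep ^ 2)); [field; assumption|rewrite unit_ep; ring].
    * transitivity (q2 y * (sin ep ^ 2 + cos ep ^ 2)); [field; assumption|rewrite unit_ep; ring].
Qed.

Lemma lens_act_on_S3 (p q k : Z) (x : quat) : on_S3 x -> on_S3 (lens_act p q k x).
Proof.
unfold on_S3, lens_act; cbv zeta; simpl q0; simpl q1; simpl q2; simpl q3; intros norm_x.
rewrite <- norm_x.
pose proof (rotation_sq (q0 x) (q3 x) (- (2 * PI * IZR k / IZR p))) as first_coordinate.
pose proof (rotation_sq (q1 x) (q2 x) (- (2 * PI * IZR k * IZR q / IZR p))) as second_coordinate.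
rewrite cos_neg, sin_neg in first_coordinate, second_coordinate.
lra.
Qed.

Lemma lens_act_0 (p q : Z) (x : quat) : lens_act p q 0 x = x.
Proof.
unfold lens_act; rewrite !Rmult_0_r, Rmult_0_l, !Rdiv_0_l, cos_0, sin_0.
apply quat_eq; simpl; ring.
Qed.

Lemma twisted_re_lens_act (p q k : Z) (x : quat) (chi : R) :
  twisted_re (lens_act p q k x) chi = twisted_re x (2 * PI * IZR k / IZR p + chi).
Proof. unfold twisted_re, lens_act; simpl; rewrite cos_plus, sin_plus; ring. Qed.

Definition covector_norm (h1 h2 h3 : R) : R := sqrt (h1 ^ 2 + h2 ^ 2 + h3 ^ 2).

Lemma covector_norm_sq (h1 h2 h3 : R) : covector_norm h1 h2 h3 ^ 2 = h1 ^ 2 + h2 ^ 2 + h3 ^ 2.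
Proof.
apply pow2_sqrt.
pose proof (pow2_ge_0 h1); pose proof (pow2_ge_0 h2); pose proof (pow2_ge_0 h3); lra.
Qed.

Section Geodesic.

Variables (I1 I3 h1 h2 h3 : R) (gam : R -> quat) (M1 M2 M3 : R -> R).
Hypotheses (I1_gt0 : 0 < I1) (I3_gt0 : 0 < I3).
Hypothesis unit_energy : (h1 ^ 2 + h2 ^ 2) / I1 + h3 ^ 2 / I3 = 1.
Hypothesis traj : hamiltonian_traj I1 I3 h1 h2 h3 gam M1 M2 M3.

Local Notation nh := (covector_norm h1 h2 h3).
Local Notation eta := (I1 / I3 - 1).
Local Notation s := (h3 / nh).
Local Notation om := (nh / (2 * I1)).

Lemma anisotropy_gt : -1 < eta.
Proof. assert (0 < I1 / I3) by now apply Rdiv_lt_0_compat. lra. Qed.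

Lemma covector_norm_gt0 : 0 < nh.
Proof.
destruct (sqrt_pos (h1 ^ 2 + h2 ^ 2 + h3 ^ 2)) as [|norm_0]; [assumption|exfalso].
pose proof (covector_norm_sq h1 h2 h3) as norm_sq; unfold covector_norm in norm_sq.
rewrite <- norm_0 in norm_sq.
pose proof (pow2_ge_0 h1); pose proof (pow2_ge_0 h2); pose proof (pow2_ge_0 h3).
replace (h1 ^ 2 + h2 ^ 2) with 0 in unit_energy by lra.
replace (h3 ^ 2) with 0 in unit_energy by lra.
rewrite !Rdiv_0_l in unit_energy; lra.
Qed.

Lemma horizontal_cosines : (h1 / nh) ^ 2 + (h2 / nh) ^ 2 = 1 - s ^ 2.
Proof.
pose proof covector_norm_gt0; pose proof (covector_norm_sq h1 h2 h3) as norm_sq.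
transitivity ((h1 ^ 2 + h2 ^ 2) / nh ^ 2); [field; lra|].
replace (h1 ^ 2 + h2 ^ 2) with (nh ^ 2 - h3 ^ 2) by lra; field; lra.
Qed.

Lemma vertical_cosine_bounds : -1 <= s <= 1.
Proof.
pose proof horizontal_cosines.
split; nra.
Qed.

Lemma covector_norm_energy : nh ^ 2 * (1 + eta * s ^ 2) = I1.
Proof.
pose proof covector_norm_gt0; pose proof (covector_norm_sq h1 h2 h3) as norm_sq.
transitivity (nh ^ 2 + eta * h3 ^ 2); [field; lra|].
rewrite norm_sq; transitivity (I1 * ((h1 ^ 2 + h2 ^ 2) / I1 + h3 ^ 2 / I3)); [field; lra|].
rewrite unit_energy; ring.
Qed.

Lemma time_of_parameter (tau : R) :
  2 * I1 * tau / nh = 2 * sqrt I1 * sqrt (1 + eta * s ^ 2) * tau.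
Proof.
pose proof covector_norm_gt0 as nh_gt0.
assert (factor : 1 + eta * s ^ 2 = I1 / nh ^ 2)
  by (rewrite <- covector_norm_energy at 2; field; lra).
rewrite factor, sqrt_div_alt, sqrt_pow2 by nra.
rewrite <- (pow2_sqrt I1) at 1 by lra; field; lra.
Qed.

Lemma cost_of_time (t : R) : 4 * (I1 * ((om * t) ^ 2 * (1 + eta * s ^ 2))) = t ^ 2.
Proof.
pose proof covector_norm_gt0.
transitivity (t ^ 2 / I1 * (nh ^ 2 * (1 + eta * s ^ 2))); [field; lra|].
rewrite covector_norm_energy; field; lra.
Qed.

Lemma vertical_momentum_constant (t : R) : M3 t = h3.
Proof.
destruct traj as [_ [_ [_ [<- flow]]]]; apply constant_of_derive_0; intros r.
replace 0 with (M1 r * (M2 r / I1) - M2 r * (M1 r / I1)) by (field; lra); apply flow.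
Qed.

Lemma horizontal_momentum_explicit (t : R) :
  M1 t = h1 * cos (2 * (om * eta * s * t)) + h2 * sin (2 * (om * eta * s * t)) /\
  M2 t = h2 * cos (2 * (om * eta * s * t)) - h1 * sin (2 * (om * eta * s * t)).
Proof.
pose proof covector_norm_gt0 as nh_gt0.
set (ep := om * eta * s).
assert (ep_eq : 2 * ep = h3 / I3 - h3 / I1) by (unfold ep; field; lra).
destruct traj as [_ [M1_0 [M2_0 [_ flow]]]].
assert (is_derive_0 : forall r, is_derive (fun _ : R => 0) r 0)
  by (intros; apply (is_derive_const (V := R_NormedModule))).
assert (momentum := imaginary_flow_unique (fun _ => mkQ 0 0 0 (2 * ep))
  (fun r => mkQ 0 (M1 r) (M2 r) 0)
  (fun r => mkQ 0 (h1 * cos (2 * (ep * r)) + h2 * sin (2 * (ep * r)))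
    (h2 * cos (2 * (ep * r)) - h1 * sin (2 * (ep * r))) 0)).
enough (mkQ 0 (M1 t) (M2 t) 0 = mkQ 0 (h1 * cos (2 * (ep * t)) + h2 * sin (2 * (ep * t)))
  (h2 * cos (2 * (ep * t)) - h1 * sin (2 * (ep * t))) 0) as explicit
  by (injection explicit; now split).
apply momentum.
- reflexivity.
- intros r; destruct (flow r) as [flow1 [flow2 _]].
  rewrite vertical_momentum_constant in flow1, flow2.
  split; [|split; [|split]]; simpl.
  + replace (0 * 0 - 0 * (2 * ep) - M1 r * 0 - M2 r * 0) with 0 by ring; apply is_derive_0.
  + replace (0 * 0 + M1 r * 0 - 0 * 0 + M2 r * (2 * ep)) with (M2 r * (h3 / I3) - h3 * (M2 r / I1))
      by (rewrite ep_eq; field; lra); exact flow1.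
  + replace (0 * 0 + M2 r * 0 + 0 * 0 - M1 r * (2 * ep)) with (h3 * (M1 r / I1) - M1 r * (h3 / I3))
      by (rewrite ep_eq; field; lra); exact flow2.
  + replace (0 * (2 * ep) + 0 * 0 + M1 r * 0 - M2 r * 0) with 0 by ring; apply is_derive_0.
- intros r; split; [|split; [|split]]; simpl; (auto_derive; [trivial|ring]).
- rewrite M1_0, M2_0, !Rmult_0_r, cos_0, sin_0; apply quat_eq; simpl; ring.
Qed.

Lemma trajectory_explicit (t : R) :
  gam t = twisted om s (h1 / nh) (h2 / nh) (om * eta * s) t.
Proof.
pose proof covector_norm_gt0 as nh_gt0.
destruct traj as [gam_0 [_ [_ [_ flow]]]].
apply (imaginary_flow_unique (twisted_rate om s (h1 / nh) (h2 / nh) (om * eta * s))).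
- reflexivity.
- intros r.
  replace (twisted_rate om s (h1 / nh) (h2 / nh) (om * eta * s) r)
    with (alg (M1 r / I1) (M2 r / I1) (M3 r / I3)); [apply flow|].
  destruct (horizontal_momentum_explicit r) as [-> ->]; rewrite vertical_momentum_constant.
  unfold alg, twisted_rate; f_equal; field; lra.
- intros r; apply is_derive_twisted, horizontal_cosines.
- rewrite gam_0; symmetry; apply twisted_0.
Qed.

Lemma trajectory_on_S3 (t : R) : on_S3 (gam t).
Proof. rewrite trajectory_explicit; apply twisted_on_S3, horizontal_cosines. Qed.

Lemma trajectory_q0 (t : R) : q0 (gam t) = zre s (om * t) (om * t * eta * s).
Proof. rewrite trajectory_explicit; simpl; f_equal; ring. Qed.

Lemma trajectory_q3 (t : R) : q3 (gam t) = zim s (om * t) (om * t * eta * s).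
Proof. rewrite trajectory_explicit; simpl; f_equal; ring. Qed.

Lemma trajectory_length (t : R) :
  curve_length I1 I3 gam (traj_velocity I1 I3 gam M1 M2 M3) 0 t = t.
Proof.
rewrite (curve_length_of_constant_speed _ _ 1); [ring|]; intros r.
unfold traj_velocity, alg; rewrite berger_norm_left by apply trajectory_on_S3.
destruct (horizontal_momentum_explicit r) as [-> ->]; rewrite vertical_momentum_constant.
transitivity (sqrt 1); [f_equal|apply sqrt_1].
transitivity ((h1 ^ 2 + h2 ^ 2) / I1 + h3 ^ 2 / I3); [|exact unit_energy].
rewrite <- (rotation_sq h1 h2 (2 * (om * eta * s * r))); field; lra.
Qed.

Lemma trajectory_q0_lens_act (p q j : Z) (t : R) :
  q0 (lens_act p q j (gam t)) = zre s (om * t) (om * t * eta * s + 2 * PI * IZR j / IZR p).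
Proof. rewrite <- zre_add, <- trajectory_q0, <- trajectory_q3; simpl; ring. Qed.

Lemma trajectory_q3_lens_act (p q j : Z) (t : R) :
  q3 (lens_act p q j (gam t)) = zim s (om * t) (om * t * eta * s + 2 * PI * IZR j / IZR p).
Proof. rewrite <- zim_add, <- trajectory_q0, <- trajectory_q3; simpl; ring. Qed.

Lemma not_minimizing_of_improvable (p q : Z) (t : R) :
  0 < t -> improvable_cost eta p s (om * t) -> ~ minimizing_upto p q I1 I3 gam M1 M2 M3 t.
Proof.
intros t_gt0 [sg [u [b [j [u_bounds [re [im cheaper]]]]]]] minimizing.
destruct (twisted_reaches sg u (b - sg * u) (lens_act p q j (gam t)))
  as [w1 [w2 [unit_axis endpoint]]]; [|rewrite re| |assumption|].
{ apply lens_act_on_S3, trajectory_on_S3. }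
{ apply trajectory_q0_lens_act. }
{ rewrite im; apply trajectory_q3_lens_act. }
specialize (minimizing _ _ 0 1 (twisted_admissible sg u w1 w2 (b - sg * u) unit_axis)).
rewrite trajectory_length, twisted_length, twisted_0, endpoint in minimizing by assumption.
replace (sg * u + (b - sg * u)) with b in minimizing by ring.
assert (shorter : sqrt (4 * (I1 * (sg ^ 2 * (1 - u ^ 2)) + I3 * b ^ 2)) < t).
{ rewrite <- (sqrt_pow2 t), <- (cost_of_time t) by lra.
  assert (0 <= sg ^ 2 * (1 - u ^ 2)) by (apply Rmult_le_pos; nra).
  assert (0 <= b ^ 2) by apply pow2_ge_0.
  apply sqrt_lt_1_alt; split.
  { apply Rmult_le_pos; [lra|apply Rplus_le_le_0_compat; apply Rmult_le_pos; lra]. }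
  apply Rmult_lt_compat_l; [lra|].
  replace (I1 * (sg ^ 2 * (1 - u ^ 2)) + I3 * b ^ 2)
    with (I1 * (sg ^ 2 * (1 - u ^ 2) + b ^ 2 / (1 + eta))) by (field; lra).
  now apply Rmult_lt_compat_l. }
enough (t <= sqrt (4 * (I1 * (sg ^ 2 * (1 - u ^ 2)) + I3 * b ^ 2))) by lra.
apply minimizing; [exists 0%Z; symmetry; apply lens_act_0|now exists j].
Qed.

Lemma minimizing_of_minimal_cost (p q : Z) (t : R) :
  minimal_cost eta p s (om * t) -> minimizing_upto p q I1 I3 gam M1 M2 M3 t.
Proof.
intros minimal c dc a b curve [k start] [j endpoint].
rewrite trajectory_length.
set (A := horizontal_length c dc a b); set (B := fibre_displacement c dc a b).
assert (cost : (om * t) ^ 2 * (1 + eta * s ^ 2) <= A ^ 2 + B ^ 2 / (1 + eta)).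
{ apply (minimal A B (j - k)%Z); intros psi.
  replace (om * t * eta * s + 2 * PI * IZR (j - k) / IZR p + psi - B)
    with (om * t * eta * s + (2 * PI * IZR j / IZR p + (- (2 * PI * IZR k / IZR p) + psi - B)))
    by (rewrite minus_IZR; unfold Rdiv; ring).
  rewrite <- zre_add, <- trajectory_q0, <- trajectory_q3.
  change (acos (twisted_re (gam t)
    (2 * PI * IZR j / IZR p + (- (2 * PI * IZR k / IZR p) + psi - B))) ^ 2 <= A ^ 2 + psi ^ 2).
  rewrite <- (twisted_re_lens_act p q), <- endpoint.
  apply acos_twisted_re_sq_le; [assumption| |]; rewrite start, ?cos_neg, ?sin_neg;
    unfold lens_act, qid; simpl; ring. }
destruct curve as [le_ab [C1 _]].
apply Rle_trans with (2 := curve_length_ge I1 I3 c dc a b I1_gt0 I3_gt0 le_ab C1).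
fold A B.
replace (I1 * A ^ 2 + I3 * B ^ 2) with (I1 * (A ^ 2 + B ^ 2 / (1 + eta))) by (field; lra).
enough (t / 2 <= sqrt (I1 * (A ^ 2 + B ^ 2 / (1 + eta)))) by lra.
apply Rle_trans with (Rabs (t / 2)); [apply Rle_abs|].
rewrite <- sqrt_Rsqr_abs, Rsqr_pow2; apply sqrt_le_1_alt.
pose proof (cost_of_time t).
apply (Rmult_le_compat_l I1) in cost; lra.
Qed.

Lemma is_cut_time_of_parameter (p q : Z) (T : R) :
  0 < T -> cut_parameter eta p s T -> is_cut_time p q I1 I3 gam M1 M2 M3 (2 * I1 * T / nh).
Proof.
intros T_gt0 [minimal improvable]; pose proof covector_norm_gt0 as nh_gt0.
assert (om_gt0 : 0 < om) by (apply Rdiv_lt_0_compat; lra).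
assert (time : om * (2 * I1 * T / nh) = T) by (field; lra).
assert (time_gt0 : 0 < 2 * I1 * T / nh) by (apply Rdiv_lt_0_compat; nra).
set (t_cut := 2 * I1 * T / nh) in *.
split.
- intros t [t_gt0 minimizing]; apply Rnot_lt_le; intros lt_t.
  apply (not_minimizing_of_improvable p q t); [assumption| |assumption].
  apply improvable; rewrite <- time; now apply Rmult_lt_compat_l.
- intros bound is_bound; apply Rnot_lt_le; intros lt_cut.
  pose proof (Rmax_l bound 0); pose proof (Rmax_r bound 0).
  pose proof (Rmax_lub_lt _ _ _ lt_cut time_gt0) as max_lt.
  set (t := (Rmax bound 0 + t_cut) / 2).
  enough (t <= bound) by (unfold t in *; lra).
  apply is_bound; split; [unfold t; lra|].
  apply minimizing_of_minimal_cost, minimal; split.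
  + apply Rmult_lt_0_compat; unfold t; lra.
  + rewrite <- time; apply Rmult_lt_compat_l; unfold t; lra.
Qed.

End Geodesic.

Lemma opp_le_mul_Rabs (c x y : R) : 0 <= c -> Rabs y <= 1 -> - c <= x -> - c <= x * Rabs y.
Proof. intros c_ge0 y_le x_ge; pose proof (Rabs_pos y); destruct (Rle_lt_dec 0 x); nra. Qed.

Lemma mul_le_opp_div_iff (c d x y : R) :
  0 < d -> x < 0 -> x * y <= - (c / d) <-> c / (d * Rabs x) <= y.
Proof.
intros d_gt0 x_lt0; rewrite Rabs_left by assumption.
rewrite (Rle_div_l c y) by nra.
split; intros le.
- assert (quotient_le : c / d <= - (x * y)) by lra; apply Rle_div_l in quotient_le; lra.
- assert (c / d <= - (x * y)) by (apply Rle_div_l; lra); lra.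
Qed.

Theorem mainTheorem8 :
  forall (p q : Z) (I1 I3 h1 h2 h3 : R) (gam : R -> quat) (M1 M2 M3 : R -> R),
    (2 <= p)%Z -> Z.gcd p q = 1%Z -> 0 < I1 -> 0 < I3 ->
    (h1 ^ 2 + h2 ^ 2) / I1 + h3 ^ 2 / I3 = 1 ->
    hamiltonian_traj I1 I3 h1 h2 h3 gam M1 M2 M3 ->
    let eta := I1 / I3 - 1 in
    let nh := sqrt (h1 ^ 2 + h2 ^ 2 + h3 ^ 2) in
    let s := h3 / nh in
    let P := IZR p in
    exists tau_m tau_p : R,
      first_pos_root (fun tau => ell eta p (-1) tau s) tau_m /\
      first_pos_root (fun tau => ell eta p 1 tau s) tau_p /\
      let tau_l := Rmin tau_m tau_p in
      (eta >= - ((P - 1) / P) ->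
         is_cut_time p q I1 I3 gam M1 M2 M3 (2 * I1 * tau_l / nh) /\
         2 * I1 * tau_l / nh = 2 * sqrt I1 * sqrt (1 + eta * s ^ 2) * tau_l) /\
      (-1 < eta < - ((P - 1) / P) ->
         (Rabs s >= (P - 1) / (P * Rabs eta) ->
            is_cut_time p q I1 I3 gam M1 M2 M3 (2 * I1 * PI / nh)) /\
         (Rabs s < (P - 1) / (P * Rabs eta) ->
            is_cut_time p q I1 I3 gam M1 M2 M3 (2 * I1 * tau_l / nh))) /\
      is_cut_time p q I1 I3 gam M1 M2 M3 (2 * I1 * Rmin PI tau_l / nh).
Proof.
intros p q I1 I3 h1 h2 h3 gam M1 M2 M3 p_ge2 _ I1_gt0 I3_gt0 unit_energy traj eta nh s P.
assert (P_ge2 : 2 <= P) by now apply IZR_le.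
assert (ratio_ge0 : 0 <= (P - 1) / P) by (apply Rdiv_le_0_compat; lra).
assert (s_bounds : -1 <= s <= 1) by now apply (vertical_cosine_bounds I1 I3).
destruct (cut_parameter_exists eta p s) as
  [tau_m [tau_p [root_m [root_p [cut [root_le_PI root_ge_PI]]]]]];
  [now apply anisotropy_gt|assumption|assumption|].
exists tau_m, tau_p; do 2 (split; [assumption|]); intros tau_l.
assert (cut_time : is_cut_time p q I1 I3 gam M1 M2 M3 (2 * I1 * Rmin PI tau_l / nh)).
{ apply is_cut_time_of_parameter; try assumption.
  apply Rmin_glb_lt; [apply PI_RGT_0|apply Rmin_glb_lt; [apply root_m|apply root_p]]. }
split; [|split; [|assumption]].
- intros eta_ge; split; [|now apply time_of_parameter].
  rewrite Rmin_right in cut_time; [assumption|].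
  apply root_le_PI, opp_le_mul_Rabs; [assumption|now apply Rabs_le|now apply Rge_le].
- intros [_ eta_lt]; assert (threshold := mul_le_opp_div_iff (P - 1) P eta (Rabs s)).
  split; intros s_threshold.
  + rewrite Rmin_left in cut_time; [assumption|]; apply root_ge_PI, threshold; lra.
  + rewrite Rmin_right in cut_time; [assumption|]; apply root_le_PI, Rlt_le, Rnot_le_lt.
    intros slope_le; apply threshold in slope_le; lra.
Qed.
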